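(* For every $n=2^s$ with integer $s\geq 4$, put $\overline{L}_n=2n\sin\frac{\pi}{2n}$, $\overline{W}_n=\cos\frac{\pi}{2n}$, $$\sigma_n=\min_{b_0,\dots,b_{n/4-1}\in\{1,-1\}}\frac{\left|\sum_{k=0}^{\frac{n}{4}-1}b_k\sin\left((2k+1)\frac{\pi}{n}\right)\right|}{\sum_{k=0}^{\frac{n}{4}-1}\cos\left((2k+1)\frac{\pi}{n}\right)},$$ and let $\delta_n\in\left(0,\frac{\pi}{n}\right)$ be the solution of $$\sigma_n\left(\cos x-\cos\frac{\pi}{n}\right)=\sin x,$$ i.e. $$\delta_n=\arccos\left(\frac{\sigma_n}{\sqrt{1+\sigma_n^2}}\cos\frac{\pi}{n}\right)-\arccos\frac{\sigma_n}{\sqrt{1+\sigma_n^2}}.$$ Then for every such $n$ there exists a convex small $n$-gon $D_n$ such that $$L(D_n)=2n\sin\frac{\pi}{2n}\cos\frac{\delta_n}{2},\qquad W(D_n)=\cos\left(\frac{\pi}{2n}+\frac{\delta_n}{2}\right),$$ and, as $n=2^s\to\infty$, $$\overline{L}_n-L(D_n)\leq O\left(\frac{\pi^{\log_2(n^2)}}{n^{\log_2 n+5}}\right),\qquad \overline{W}_n-W(D_n)\leq O\left(\frac{\pi^{\log_2(n^2)}}{n^{\log_2 n+7}}\right).$$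
   Context: The diameter of a convex polygon is the maximum distance between pairs of its vertices. A polygon is small if its diameter equals one. $L(P)$ denotes the perimeter of a polygon $P$. The height associated to a side of $P$ is the maximum distance between a vertex of $P$ and the line containing that side; the width $W(P)$ is the minimum of the heights over all sides of $P$. The numbers $\overline{L}_n$ and $\overline{W}_n$ are known upper bounds on the perimeter and on the width, respectively, of any convex small $n$-gon. The $O(\cdot)$ notation refers to an absolute implied constant: $A_n\le O(B_n)$ means that there is a constant $C$, independent of $n$, with $A_n\le C B_n$. *)

(* Defs.v *)
From HB Require Import structures.
From mathcomp Require Import all_boot all_order all_algebra.
From mathcomp Require Import all_classical all_reals all_analysis.

Set Implicit Arguments.
Unset Strict Implicit.
Unset Printing Implicit Defensive.

Import Order.TTheory GRing.Theory Num.Theory.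

Local Open Scope classical_set_scope.
Local Open Scope ring_scope.

Section Polygons.
Variable R : realType.

(* The canonical norm on R * R is the sup norm, hence a separate Euclidean
   distance. *)
Definition edist2 (p q : R * R) : R :=
  Num.sqrt ((p.1 - q.1) ^+ 2 + (p.2 - q.2) ^+ 2).

Definition line (p q : R * R) : set (R * R) :=
  range (fun t : R => p + t *: (q - p)).

Definition dist_to_line (p q x : R * R) : R := inf (edist2 x @` line p q).

(* Positive iff p, q, x form a counterclockwise triangle. *)
Definition orient (p q x : R * R) : R :=
  (q.1 - p.1) * (x.2 - p.2) - (q.2 - p.2) * (x.1 - p.1).

(* Vertices in cyclic order; the i-th side joins P i and P (ordS i). *)
Definition polygon (n : nat) := 'I_n -> R * R.

(* Vertices are listed counterclockwise, and every side has all the other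
   vertices strictly on its left: the n vertices are therefore distinct, no
   three are collinear, and the polygon has exactly n corners. *)
Definition convex_polygon n (P : polygon n) : Prop :=
  forall i j : 'I_n, j != i -> j != ordS i -> 0 < orient (P i) (P (ordS i)) (P j).

Definition diameter n (P : polygon n) : R :=
  \big[Num.max/0]_(i < n) \big[Num.max/0]_(j < n) edist2 (P i) (P j).

Definition small n (P : polygon n) : Prop := diameter P = 1.

Definition perimeter n (P : polygon n) : R :=
  \sum_(i < n) edist2 (P i) (P (ordS i)).

Definition height n (P : polygon n) (i : 'I_n) : R :=
  \big[Num.max/0]_(j < n) dist_to_line (P i) (P (ordS i)) (P j).

(* For 0 < n, the infimum of a nonempty finite set, hence its minimum. *)
Definition width n (P : polygon n) : R := inf (range (height P)).

End Polygons.

Section Bounds.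
Variable R : realType.

Definition Lbar (n : nat) : R := 2 * n%:R * sin (pi / (2 * n%:R)).

Definition Wbar (n : nat) : R := cos (pi / (2 * n%:R)).

(* The sign b_k is (-1) ^+ b k. *)
Definition sigma_ratio (n : nat) (b : {ffun 'I_(n %/ 4) -> bool}) : R :=
  `| \sum_(k < n %/ 4) (-1) ^+ b k * sin ((2 * k + 1)%:R * (pi / n%:R)) |
  / \sum_(k < n %/ 4) cos ((2 * k + 1)%:R * (pi / n%:R)).

(* A minimum over a finite type, initialised at the all-plus choice of signs. *)
Definition sigma (n : nat) : R :=
  \big[Num.min/@sigma_ratio n [ffun=> false]]_(b : {ffun 'I_(n %/ 4) -> bool})
    sigma_ratio b.

Definition delta_solution (n : nat) (x : R) : Prop :=
  0 < x < pi / n%:R /\ sigma n * (cos x - cos (pi / n%:R)) = sin x.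

Definition delta (n : nat) : R :=
  acos (sigma n / Num.sqrt (1 + sigma n ^+ 2) * cos (pi / n%:R))
  - acos (sigma n / Num.sqrt (1 + sigma n ^+ 2)).

Definition log2 (x : R) : R := ln x / ln 2.

End Bounds.

(* Main.v *)
(* Geometry.  Let the unit vector u(theta) turn through angles theta_0 < theta_1
   < ... whose gaps are pi/n + delta and pi/n - delta in some order, let each
   increment u(theta_(j+1)) - u(theta_j) be assigned to one of the two ends of a
   diameter, and let p_j trace one end over a full turn.  If the walk closes up,
   p_j - p_(j+n) = u(theta_j) for all j and the p_j are the vertices of a polygon
   inscribed in a Reuleaux polygon of width 1: its sides are the bases of
   isosceles triangles of legs 1 and apex angle pi/n + delta or pi/n - delta,
   which gives the perimeter and the width.  Taking the increments in pairs
   (2k, 2k+1), symmetrically about an axis, closing up reduces to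
   |sum b_k sin((2k+1) pi/n)| (cos delta - cos(pi/n)) =
   sin(delta) sum cos((2k+1) pi/n), the equation of delta for optimal signs.
   It has a root in (0, pi/n) because sigma_n <> 0: the sines divided by
   sin(pi/n) are monic integer polynomials of degrees 0, ..., n/4 - 1 in
   2 cos(2 pi/n), which has degree n/4 over the rationals by Eisenstein.

   Rates.  The width gap is of order delta/n, so the second rate needs
   sigma_n = 2^(-s^2 + O(s)), whereas Thue-Morse signs only give
   2^(-s^2/2 + O(s)).  Multiplying the step-2y samples of a sine by the
   coefficients of prod (1 - X^(a_i)) gives a sine of amplitude
   prod 2 sin(a_i y).  For the fixed product [template], of 20 factors,
   with coefficients in {-1, 0, 1} and degree below 2^9, the dilates by powers
   of two act on disjoint windows of 9 bits of the index k, and a product of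
   about s/9 of them has amplitude 2^(-(20/18) s^2 (1 - o(1))).  Reserving a
   few low bits of k to keep the supports disjoint, one gets combinations whose
   amplitudes form a ladder from 1 down to that size, with bounded ratios and a
   bounded number of copies of each rung; the remaining terms are signed so that
   their sum is at most 1, and the signs of the rungs are then chosen greedily. *)
Require Import Defs.
From HB Require Import structures.
From mathcomp Require Import all_boot all_order all_algebra.
From mathcomp Require Import all_classical all_reals all_analysis.
From mathcomp Require Import ring lra zify.

Import Order.TTheory GRing.Theory Num.Theory.

Local Open Scope ring_scope.

(** * Euclidean distance to a line *)

Section PlaneGeometry.
Set Implicit Arguments.
Unset Strict Implicit.
Variable R : realType.

Lemma inf_attained (E : set R) (c : R) : E c -> lbound E c -> inf E = c.
Proof.
move=> Ec cE; apply/eqP; rewrite eq_le; apply/andP; split.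
  by apply: ge_inf => //; exists c.
by apply: lb_le_inf => //; exists c.
Qed.

Lemma dist_to_lineE (p q x : R * R) : edist2 q p != 0 ->
  dist_to_line p q x = `|orient p q x| / edist2 q p.
Proof.
case: p q x => [p1 p2] [q1 q2] [x1 x2]; set l := edist2 _ _ => l0.
have l2 : l ^+ 2 = (q1 - p1) ^+ 2 + (q2 - p2) ^+ 2.
  by rewrite sqr_sqrtr// addr_ge0// sqr_ge0.
have lp : 0 < l by rewrite lt_neqAle eq_sym l0 sqrtr_ge0.
pose N := (x1 - p1) * (q1 - p1) + (x2 - p2) * (q2 - p2).
pose t0 := N / l ^+ 2.
set D := orient _ _ _.
(* Pythagoras: the squared distance from [x] to the point of parameter [t] is the squared height
   plus the squared distance from that point to the foot of the perpendicular, of parameter [t0]. *)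
have sq t : (x1 - (p1 + t * (q1 - p1))) ^+ 2 + (x2 - (p2 + t * (q2 - p2))) ^+ 2
    = (`|D| / l) ^+ 2 + (l * (t - t0)) ^+ 2.
  have -> : (l * (t - t0)) ^+ 2 =
    t ^+ 2 * l ^+ 2 - 2 * t * (t0 * l ^+ 2) + (t0 * l ^+ 2) ^+ 2 / l ^+ 2.
    by field.
  rewrite expr_div_n real_normK ?num_real//.
  have -> : t0 * l ^+ 2 = N by rewrite /t0 divfK// sqrf_eq0.
  have DN : D ^+ 2 + N ^+ 2 = ((x1 - p1) ^+ 2 + (x2 - p2) ^+ 2) * l ^+ 2.
    by rewrite l2 /D /N /orient /=; ring.
  have -> : D ^+ 2 / l ^+ 2 + (t ^+ 2 * l ^+ 2 - 2 * t * N + N ^+ 2 / l ^+ 2) =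
      (D ^+ 2 + N ^+ 2) / l ^+ 2 + (t ^+ 2 * l ^+ 2 - 2 * t * N) by ring.
  by rewrite DN mulfK ?sqrf_eq0// l2 /N; ring.
apply: inf_attained.
  exists (p1 + t0 * (q1 - p1), p2 + t0 * (q2 - p2)); first by exists t0.
  rewrite /edist2 /= sq subrr mulr0 expr0n addr0 sqrtr_sqr ger0_norm//.
  by rewrite divr_ge0 ?normr_ge0// ltW.
move=> _ [_ [t _ <-] <-]; rewrite /edist2 /= /GRing.scale /= sq.
have d0 : 0 <= `|D| / l by rewrite divr_ge0 ?normr_ge0// ltW.
by rewrite -[leLHS]ger0_norm// -sqrtr_sqr ler_sqrt ?addr_ge0 ?sqr_ge0// lerDl sqr_ge0.
Qed.

Lemma edist2C (p q : R * R) : edist2 p q = edist2 q p.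
Proof.
rewrite /edist2 -sqrrN opprB; congr (Num.sqrt (_ + _)).
by rewrite -sqrrN opprB.
Qed.

End PlaneGeometry.

(** * Polygons traced by one end of a turning unit diameter *)

Section Reuleaux.
Set Implicit Arguments.
Unset Strict Implicit.
Variable R : realType.

Definition dir (x : R) : R * R := (cos x, sin x).

Definition proj (x : R) (q : R * R) : R := q.1 * cos x + q.2 * sin x.

Lemma projD x q q' : proj x (q + q') = proj x q + proj x q'.
Proof. by rewrite /proj /=; ring. Qed.

Lemma projB x q q' : proj x (q - q') = proj x q - proj x q'.
Proof. by rewrite /proj /=; ring. Qed.

Lemma proj0 x : proj x 0 = 0.
Proof. by rewrite /proj /= !mul0r addr0. Qed.

Lemma proj_dir x y : proj x (dir y) = cos (y - x).
Proof. by rewrite /proj /dir /= cosB. Qed.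

Lemma projDpi x q : proj (x + pi) q = - proj x q.
Proof. by rewrite /proj cosDpi sinDpi; ring. Qed.

Lemma dirDpi x : dir (x + pi) = - dir x.
Proof. by rewrite /dir cosDpi sinDpi. Qed.

Lemma edist2_dir (x r : R) (q q' : R * R) :
  q - q' = r *: dir x -> edist2 q q' = `|r|.
Proof.
rewrite /edist2 => /[dup] /(congr1 fst) /= -> /(congr1 snd) /= ->.
rewrite -sqrtr_sqr; congr Num.sqrt; rewrite /GRing.scale /=.
by rewrite !exprMn -mulrDr cos2Dsin2 mulr1.
Qed.

Lemma dirB x y :
  dir y - dir x = (2 * sin ((y - x) / 2)) *: dir ((x + y) / 2 + pi / 2).
Proof.
have -> : dir y = dir ((x + y) / 2 + (y - x) / 2) by congr dir; lra.
have -> : dir x = dir ((x + y) / 2 - (y - x) / 2) by congr dir; lra.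
rewrite /dir /GRing.scale /= cosDpihalf sinDpihalf !cosD !sinD cosN sinN.
by congr pair => /=; rewrite /GRing.scale /=; ring.
Qed.

(* Swapping two vertices brings their difference into the right half-plane,
   where the arcsine provides the polar angle. *)
Lemma polar_right (q : R * R) : 0 <= q.1 ->
  exists x : R, [/\ - (pi / 2) <= x, x <= pi / 2 &
    Num.sqrt (q.1 ^+ 2 + q.2 ^+ 2) = proj x q].
Proof.
case: q => a b /= a0; set r := Num.sqrt _.
have r2 : r ^+ 2 = a ^+ 2 + b ^+ 2 by rewrite sqr_sqrtr// addr_ge0// sqr_ge0.
have [r0|rn0] := eqVneq r 0.
  exists 0; have pi0 := pi_gt0 R; split; [lra|lra|].
  have : a ^+ 2 + b ^+ 2 = 0 by rewrite -r2 r0 expr0n.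
  move/eqP; rewrite paddr_eq0 ?sqr_ge0// !sqrf_eq0 => /andP[/eqP-> /eqP->].
  by rewrite r0 /proj /= !mul0r addr0.
have rp : 0 < r by rewrite lt_neqAle eq_sym rn0 sqrtr_ge0.
have br : -1 <= b / r <= 1.
  rewrite -ler_norml normrM normfV (gtr0_norm rp) ler_pdivrMr// mul1r.
  by rewrite -sqrtr_sqr ler_sqrt ?addr_ge0 ?sqr_ge0// lerDr sqr_ge0.
exists (asin (b / r)); split; [exact: asin_geNpi2|exact: asin_lepi2|].
rewrite /proj /= asinK ?in_itv//= cos_asin//.
have -> : 1 - (b / r) ^+ 2 = (a / r) ^+ 2.
  have : r ^+ 2 != 0 by rewrite sqrf_eq0.
  by rewrite !expr_div_n; move=> ?; rewrite -[1](divff (x := r ^+ 2))//;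
     rewrite {1}r2; field.
rewrite sqrtr_sqr ger0_norm; last by rewrite divr_ge0// ltW.
by rewrite !mulrA -mulrDl -!expr2 -r2 expr2 mulfK.
Qed.

(** At step [j] the diameter turns from [theta j] to [theta j.+1]; [eta j] tells whether the traced
    end [p j] moves or the opposite end [p (j + n)]. *)
Variables (n : nat) (theta : nat -> R) (eta : nat -> bool) (p : nat -> R * R).
Hypothesis theta_lt : forall j, theta j < theta j.+1.
Hypothesis theta_half : forall j, theta (j + n)%N = theta j + pi.
Hypothesis eta_half : forall j, eta (j + n)%N = ~~ eta j.
Hypothesis p_step : forall j, p j.+1 =
  p j + (if eta j then dir (theta j.+1) - dir (theta j) else 0).
Hypothesis p_half0 : p 0 - p n = dir (theta 0).

Lemma theta_le i j : (i <= j)%N -> theta i <= theta j.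
Proof.
move=> /subnK <-; elim: (j - i)%N => [|k IH]//.
by rewrite addSn (le_trans IH)// ltW.
Qed.

(** Exactly one of the two ends moves at each step, and either way their difference changes by
    [dir (theta j.+1) - dir (theta j)]. *)
Lemma antipodal j : p j - p (j + n) = dir (theta j).
Proof.
elim: j => [|j IH]; first by rewrite add0n.
rewrite addSn !p_step eta_half -addSn !theta_half !dirDpi.
move/(canRL (subrK _)): IH => ->.
by case: (eta j) => /=; rewrite ?addr0;
   congr pair => /=; ring.
Qed.

Lemma p_period j : p (j + n + n) = p j.
Proof.
have := antipodal (j + n); rewrite theta_half dirDpi -antipodal.
by rewrite opprB => /addrI/oppr_inj.
Qed.

Lemma p_periodM k j : p (j + k * (n + n)) = p j.
Proof.
elim: k => [|k IH]; first by rewrite addn0.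
by rewrite mulSn addnCA addnC -IH -[in RHS](p_period (j + _)) addnA.
Qed.

Lemma proj_step x j : proj x (p j.+1) = proj x (p j) +
  (if eta j then cos (theta j.+1 - x) - cos (theta j - x) else 0).
Proof.
rewrite p_step projD; congr (_ + _).
by case: (eta j); rewrite ?proj0// projB !proj_dir.
Qed.

Lemma proj_step_lt x j : x <= theta j -> theta j.+1 <= x + pi -> eta j ->
  proj x (p j.+1) < proj x (p j).
Proof.
move=> xj jx ej; rewrite proj_step ej gtrDl subr_lt0.
have := theta_lt j => ?.
by rewrite ltr_cos ?in_itv/=; lra.
Qed.

(** While [theta] stays in [[x, x + pi]], the cosine of [theta - x] decreases, so every move lowers
    the projection and every rest keeps it. *)
Lemma proj_decr x i j : (i <= j)%N -> x <= theta i -> theta j <= x + pi ->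
  proj x (p j) <= proj x (p i).
Proof.
move=> /subnK <-; elim: (j - i)%N => [|k IH]// xi.
rewrite addSn => kx; have lk := theta_lt (k + i).
apply: le_trans (IH xi _); last lra.
have [e|e] := boolP (eta (k + i)).
  by rewrite ltW// proj_step_lt// (le_trans xi)// theta_le// leq_addl.
by rewrite proj_step (negbTE e) addr0.
Qed.

Lemma proj_incr x i j : (i <= j)%N -> x + pi <= theta i ->
  theta j <= x + pi + pi -> proj x (p i) <= proj x (p j).
Proof.
by move=> ij xi jx; rewrite -lerN2 -!projDpi proj_decr.
Qed.

Lemma p_window a m : (0 < n)%N -> exists2 m', (a < m' <= a + n + n)%N & p m = p m'.
Proof.
move=> n0; set N := (n + n)%N.
have N0 : (0 < N)%N by rewrite addn_gt0 n0.
pose b := (m + a.+1 * N - a.+1)%N.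
have ab : (a.+1 <= m + a.+1 * N)%N by rewrite (leq_trans _ (leq_addl _ _))// leq_pmulr.
exists (a.+1 + b %% N)%N.
  rewrite ltnS leq_addr/= -addnA -/N addSn -addnS leq_add2l.
  by rewrite ltn_mod.
rewrite -(p_periodM (b %/ N) (a.+1 + _)) -/N -addnA [X in (_ + X)%N]addnC -divn_eq.
by rewrite /b subnKC// p_periodM.
Qed.

Lemma n_gt0 : (0 < n)%N.
Proof.
rewrite lt0n; apply/eqP => n0; have := theta_half 0.
by rewrite n0 addn0; have := pi_gt0 R; lra.
Qed.

(** Over the full turn after [j] the projection falls up to index [j + n] and rises from index
    [j.+1 + n] on; the bounds are the values at the ends of these two stretches. *)
Lemma support x j m : theta j <= x -> x <= theta j.+1 ->
  [\/ proj x (p (j + n)) <= proj x (p m) <= proj x (p j.+1)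
   | proj x (p (j.+1 + n)) <= proj x (p m) <= proj x (p j)].
Proof.
move=> jx xj; have [m' /andP[jm mj] ->] := p_window j m n_gt0.
have hj := theta_half j; have hj1 := theta_half j.+1.
have hj2 := theta_half (j + n); have lj := theta_lt j.
have [mn|mn] := leqP m' (j + n).
  have := theta_le mn; have := theta_le jm.
  by left; apply/andP; split; apply: proj_decr => //; lra.
have := theta_le mj; have : theta (j.+1 + n) <= theta m' by rewrite theta_le// addSn.
right; apply/andP; split.
  by apply: proj_incr => //; lra.
by rewrite -(p_period j); apply: proj_incr => //; lra.
Qed.

Lemma proj_antipodal x j : proj x (p j) - proj x (p (j + n)) <= 1.
Proof. by rewrite -projB antipodal proj_dir cos_le1. Qed.

(** Only one end moves at step [j], so the extreme projections left by [support] belong to the two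
    ends of a single diameter, that of index [j] or [j.+1]. *)
Lemma proj_diam x j m m' : theta j <= x -> x <= theta j.+1 ->
  proj x (p m) - proj x (p m') <= 1.
Proof.
move=> jx xj.
have a0 := proj_antipodal x j; have a1 := proj_antipodal x j.+1.
have s0 := proj_step x j; have := proj_step x (j + n).
rewrite eta_half -addSn => s1.
case: (support m jx xj) (support m' jx xj) => /andP[? ?] [] /andP[? ?];
  by move: s0 s1; case: (eta j) => /= s0 s1; lra.
Qed.

Lemma edist2_le1 m m' : theta 0 = - (pi / 2) -> edist2 (p m) (p m') <= 1.
Proof.
move=> th0; wlog D : m m' / 0 <= (p m - p m').1.
  move=> H; have [/H//|D] := leP 0 (p m - p m').1.
  rewrite /edist2 -sqrrN -[X in _ + X]sqrrN !opprB -/(edist2 (p m') (p m)).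
  by apply: H; move: D => /=; lra.
have [x [x0 x1]] := polar_right D; rewrite /edist2 => ->; rewrite projB.
(* The directions [theta 0], ..., [theta n] sweep from [- pi / 2] to [pi / 2], so some step contains
   the polar angle [x]. *)
have [j jn] : exists j, theta j <= x <= theta j.+1.
  have thn := theta_half 0; rewrite add0n in thn.
  have: x <= theta n by lra.
  elim: n => [|k IH] xk; first by exists 0; have := theta_lt 0; lra.
  by have [/IH//|kx] := leP x (theta k); exists k; rewrite (ltW kx).
by move/andP: jn => [? ?]; apply: proj_diam; eassumption.
Qed.

Lemma edist2_antipodal j : edist2 (p j) (p (j + n)) = 1.
Proof. by rewrite (@edist2_dir (theta j) 1) ?normr1// scale1r antipodal. Qed.

Definition mid j : R := (theta j + theta j.+1) / 2.

Definition gap j : R := theta j.+1 - theta j.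

Lemma gap_gt0 j : 0 < gap j.
Proof. by rewrite subr_gt0. Qed.

Lemma gap_half j : gap (j + n) = gap j.
Proof. by rewrite /gap -addSn !theta_half; lra. Qed.

Lemma gap_le_pi j : gap j <= pi.
Proof.
have := theta_half j; rewrite /gap.
have : theta j.+1 <= theta (j + n) by rewrite theta_le// -addn1 leq_add2l n_gt0.
lra.
Qed.

Lemma sin_gap_gt0 j : 0 < sin (gap j / 2).
Proof.
have := gap_gt0 j; have := gap_le_pi j; have := pi_gt0 R => *.
by apply: sin_gt0_pi; lra.
Qed.

Lemma side_length j : eta j -> edist2 (p j) (p j.+1) = 2 * sin (gap j / 2).
Proof.
move=> ej; rewrite (@edist2_dir (mid j + pi / 2) (- (2 * sin (gap j / 2)))).
  by rewrite normrN ger0_norm// mulr_ge0// ltW// sin_gap_gt0.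
by rewrite p_step ej scaleNr -dirB opprD addNKr.
Qed.

Lemma orient_proj j m : eta j ->
  orient (p j) (p j.+1) (p m) =
  2 * sin (gap j / 2) * (proj (mid j) (p j) - proj (mid j) (p m)).
Proof.
move=> ej; have E : p j.+1 - p j = dir (theta j.+1) - dir (theta j).
  by rewrite p_step ej addrC addKr.
rewrite /orient -[(p j.+1).1 - _]/((p j.+1 - p j).1)
  -[(p j.+1).2 - _]/((p j.+1 - p j).2) E dirB -/(gap j) -/(mid j) /GRing.scale /= /GRing.scale /= cosDpihalf sinDpihalf.
by rewrite /proj; ring.
Qed.

Lemma proj_mid_side j : proj (mid j) (p j) = proj (mid j) (p j.+1).
Proof.
rewrite proj_step; case: (eta j); rewrite ?addr0//.
have -> : theta j - mid j = - (theta j.+1 - mid j) by rewrite /mid; lra.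
by rewrite cosN subrr addr0.
Qed.

Lemma proj_mid_height j : eta j ->
  proj (mid j) (p j) - proj (mid j) (p (j + n)) = cos (gap j / 2).
Proof.
move=> ej; rewrite -projB antipodal proj_dir -cosN.
by congr cos; rewrite /mid /gap; lra.
Qed.

(** The side is perpendicular to [mid j] and the opposite end rests at step [j], so both cases of
    [support] give the same bounds: the side on top, [p (j + n)] at the bottom. *)
Lemma proj_mid_bounds j m : eta j ->
  0 <= proj (mid j) (p j) - proj (mid j) (p m) <= cos (gap j / 2).
Proof.
move=> ej; rewrite -proj_mid_height//.
have g0 := gap_gt0 j.
have jm : theta j <= mid j by move: g0; rewrite /gap /mid; lra.
have mj : mid j <= theta j.+1 by move: g0; rewrite /gap /mid; lra.
have e := proj_step (mid j) (j + n); rewrite eta_half ej addr0 -addSn in e.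
have e' := proj_mid_side j.
by case: (support m jm mj) => /andP[]; lra.
Qed.

Hypothesis eta_pair : forall K, eta K.*2.+1 = ~~ eta K.*2.

(** Each pair of steps [K.*2], [K.*2.+1] moves the traced end exactly once, so the even indices run
    through all its positions. *)
Definition even_vertices : polygon R n := fun i => p i.*2.

Definition side_index K := if eta K.*2 then K.*2 else K.*2.+1.

Lemma eta_side K : eta (side_index K).
Proof. by rewrite /side_index; case: ifP => // e; rewrite eta_pair e. Qed.

Lemma side_index_bounds K : (K.*2 <= side_index K <= K.*2.+1)%N.
Proof. by rewrite /side_index; case: ifP; rewrite leqnn ?leqnSn ?ltnS. Qed.

Lemma p_side K : p (side_index K) = p K.*2.
Proof.
by rewrite /side_index; case: ifP => // e; rewrite p_step e addr0.
Qed.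

Lemma p_sideS K : p (side_index K).+1 = p K.*2.+2.
Proof.
rewrite /side_index; case: ifP => // e.
by rewrite [RHS]p_step eta_pair e addr0.
Qed.

(** Strictness comes from a moving step [l] inside the arc where the cosine is strictly monotone: a
    step of pair [K.+1] if [j.*2] does not pass the opposite index [k + n], of pair [j]
    otherwise. *)
Lemma proj_mid_strict K j : (K.+1 < j < K + n)%N ->
  proj (mid (side_index K)) (p j.*2) < proj (mid (side_index K)) (p (side_index K)).
Proof.
set k := side_index K => /andP[Kj jK].
have /andP[k1 k2] : (K.*2 <= k <= K.*2.+1)%N by exact: side_index_bounds.
have g0 := gap_gt0 k; rewrite /gap in g0.
have jm : theta k <= mid k by rewrite /mid; lra.
have mj : mid k <= theta k.+1 by rewrite /mid; lra.
have hk := theta_half k; have hk1 := theta_half k.+1; have hk2 := theta_half (k + n).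
have [jn|jn] := leqP j.*2 (k + n).
  have /andP[l1 l2] := side_index_bounds K.+1; set l := side_index K.+1 in l1 l2.
  have := theta_le (_ : k.+1 <= l)%N; have := theta_le (_ : l.+1 <= j.*2)%N.
  have := theta_le jn; rewrite doubleS in l1 l2.
  move=> t1 /(_ ltac:(lia)) t2 /(_ ltac:(lia)) t3; have lt := theta_lt l.
  apply: (@le_lt_trans _ _ (proj (mid k) (p l.+1))).
    by apply: proj_decr; [lia|lra|lra].
  apply: (@lt_le_trans _ _ (proj (mid k) (p l))).
    by apply: proj_step_lt; [lra|lra|exact: eta_side].
  by rewrite proj_mid_side; apply: proj_decr; [lia|lra|lra].
have /andP[l1 l2] := side_index_bounds j; rewrite -(p_side j).
set l := side_index j in l1 l2 *.
have := theta_le (_ : k.+1 + n <= l)%N; have := theta_le (_ : l.+1 <= k + n + n)%N.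
move=> /(_ ltac:(lia)) t1 /(_ ltac:(lia)) t2; have lt := theta_lt l.
apply: (@lt_le_trans _ _ (proj (mid k) (p l.+1))).
  by rewrite -ltrN2 -!projDpi; apply: proj_step_lt; [lra|lra|exact: eta_side].
by rewrite -[p k]p_period; apply: proj_incr; [lia|lra|lra].
Qed.

Lemma even_verticesS (i : 'I_n) : even_vertices (ordS i) = p (side_index i).+1.
Proof.
rewrite p_sideS /even_vertices /=.
have [iE|ni] := eqVneq i.+1 n.
  by rewrite iE modnn double0 -[in LHS](p_period 0) add0n; congr p; lia.
by rewrite modn_small// ltn_neqAle ni ltn_ord.
Qed.

Lemma even_verticesE (i : 'I_n) : even_vertices i = p (side_index i).
Proof. by rewrite p_side. Qed.

Lemma even_vertices_convex : convex_polygon even_vertices.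
Proof.
move=> i j ji jSi; rewrite even_verticesS even_verticesE orient_proj ?eta_side//.
rewrite mulr_gt0 ?mulr_gt0 ?sin_gap_gt0// subr_gt0.
have li := ltn_ord i; have lj := ltn_ord j.
move: ji jSi; rewrite -!val_eqE /= => ji jSi.
have [ij|ij] := ltnP i j.
  rewrite modn_small in jSi; last by lia.
  by apply: proj_mid_strict; lia.
have -> : p j.*2 = p (j + n).*2 by rewrite -(p_period j.*2); congr p; lia.
apply: proj_mid_strict; have [iE|iE] := eqVneq i.+1 n; last by lia.
by move: jSi; rewrite iE modnn; lia.
Qed.

Lemma even_vertices_small : ~~ odd n -> theta 0 = - (pi / 2) ->
  small even_vertices.
Proof.
move=> en th0; apply/eqP; rewrite eq_le; apply/andP; split.
  by do 2 (apply: bigmax_le => // ? _); exact: edist2_le1.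
(* As [n] is even, the vertex of rank [n./2] is [p n], the antipode of [p 0]. *)
have n0 := n_gt0; have hn : (n./2 < n)%N by lia.
rewrite /diameter; apply: (bigmax_sup (Ordinal n0)) => //.
apply: (bigmax_sup (Ordinal hn)) => //.
by rewrite /even_vertices /= even_halfK// -[X in p X]add0n double0 edist2_antipodal.
Qed.

Lemma even_vertices_height (i : 'I_n) :
  height even_vertices i = cos (gap (side_index i) / 2).
Proof.
set k := side_index i; have ek : eta k := eta_side i.
have distE j : dist_to_line (even_vertices i) (even_vertices (ordS i)) (p j)
    = proj (mid k) (p k) - proj (mid k) (p j).
  have sp := sin_gap_gt0 k; have := proj_mid_bounds j ek => /andP[b0 _].
  rewrite even_verticesS even_verticesE dist_to_lineE edist2C side_length//.
    by rewrite orient_proj// normrM ger0_norm ?mulr_ge0 ?ltW// ger0_norm// mulrC mulKf ?mulf_neq0 ?gt_eqF.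
  by rewrite mulf_neq0// gt_eqF.
have c0 : 0 <= cos (gap k / 2).
  by have := proj_mid_bounds k ek; rewrite subrr lexx.
rewrite /height; apply/eqP; rewrite eq_le; apply/andP; split.
  apply: bigmax_le => // j _; rewrite distE.
  by have /andP[] := proj_mid_bounds j.*2 ek.
(* If [k + n] is odd, the traced end rests at that step, so the opposite point also occurs at the
   next, even index. *)
have [j jE] : exists j : 'I_n, p j.*2 = p (k + n)%N.
  have n0 := n_gt0.
  have lm : (((k + n)./2 + odd (k + n)) %% n < n)%N by rewrite ltn_mod.
  have e1 : p ((k + n)./2 + odd (k + n))%N.*2 = p (k + n)%N.
    have := odd_double_half (k + n); case ko : (odd (k + n)) => /= e; last first.
      by congr p; lia.
    have -> : (((k + n)./2 + 1).*2 = (k + n).+1)%N by lia.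
    by rewrite [LHS]p_step eta_half ek addr0.
  exists (Ordinal lm) => /=; rewrite -[RHS]e1.
  set m := (_ + _)%N; rewrite [in RHS](divn_eq m n) -(p_periodM (m %/ n) (m %% n).*2).
  by congr p; lia.
apply: (bigmax_sup j) => //.
by rewrite [even_vertices j]jE distE proj_mid_height.
Qed.

Lemma even_vertices_perimeter :
  perimeter even_vertices = \sum_(i < n) 2 * sin (gap (side_index i) / 2).
Proof.
by apply: eq_bigr => i _; rewrite even_verticesS even_verticesE side_length ?eta_side.
Qed.

End Reuleaux.

(** * Closing up the walk given by a choice of signs *)

Section Construction.
Set Implicit Arguments.
Unset Strict Implicit.

Lemma sum_pairs (V : zmodType) (F : nat -> V) m :
  \sum_(0 <= j < m.*2) F j = \sum_(0 <= k < m) (F k.*2 + F k.*2.+1).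
Proof.
elim: m => [|m IH]; first by rewrite !big_nil.
by rewrite doubleS !big_nat_recr//= IH addrA.
Qed.

Lemma sum_halves (V : zmodType) (F : nat -> V) m :
  \sum_(0 <= j < m.*2) F j = \sum_(0 <= k < m) (F k + F (k + m)%N).
Proof.
rewrite -addnn (@big_cat_nat _ _ _ m)//= ?leq_addr// big_split/=; congr (_ + _).
by rewrite -{1}[m]add0n big_addn addnK.
Qed.

Lemma sum_mirror (V : zmodType) (F : nat -> V) m :
  \sum_(0 <= j < m.*2) F j = \sum_(0 <= k < m) (F (m - k.+1)%N + F (m + k)%N).
Proof.
rewrite sum_halves !big_split/=; congr (_ + _).
  by rewrite big_nat_rev/= add0n.
by apply: eq_bigr => k _; rewrite addnC.
Qed.

Variable R : realType.
Variables (q : nat) (b : nat -> bool) (dlt : R).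
Hypothesis q0 : (0 < q)%N.
Variables (n : nat) (h : R).
Hypothesis nq : n = (4 * q)%N.
Hypothesis hE : h = pi / n%:R.
Hypothesis dlt0 : 0 < dlt.
Hypothesis dlth : dlt < h.
Variables S T : R.
Hypothesis SE : S = \sum_(0 <= k < q) (-1) ^+ b k * sin ((2 * k + 1)%:R * h).
Hypothesis TE : T = \sum_(0 <= k < q) cos ((2 * k + 1)%:R * h).
Hypothesis dltE : `|S| * (cos dlt - cos h) = sin dlt * T.

(** The sign chooses which step of the pair moves. Pairs mirrored about direction 0 get opposite
    signs, so that the cosine components cancel. *)
Definition pair_sign K : bool := if (K < q)%N then ~~ b (q - K.+1) else b (K - q)%N.

(** Tying the shift to [pair_sign] makes all cosines enter the sine closing condition with one
    common sign, chosen to counteract [S]. *)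
Definition shift_sign K : bool := ~~ (pair_sign K (+) (S < 0)).

Definition angle j : R :=
  - (pi / 2) + j%:R * h + (if odd j then (-1) ^+ shift_sign (j %% n)./2 * dlt else 0).

Definition moves j : bool := pair_sign (j %% n)./2 (+) ~~ odd j (+) odd (j %/ n).

Definition walk j : R * R :=
  (\sum_(0 <= m < j) (if moves m then cos (angle m.+1) - cos (angle m) else 0),
   \sum_(0 <= m < j) (if moves m then sin (angle m.+1) - sin (angle m) else 0)).

Let nE : n = (q.*2).*2. Proof. by lia. Qed.
Let n0 : (0 < n)%N. Proof. by lia. Qed.
Let on : odd n = false. Proof. by rewrite nE odd_double. Qed.
Let nh : n%:R * h = pi.
Proof. by rewrite hE mulrC divfK// pnatr_eq0; lia. Qed.

Lemma sign_cases (c : bool) (x : R) : (-1) ^+ c * x = x \/ (-1) ^+ c * x = - x.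
Proof. by case: c; [right|left]; rewrite ?expr0 ?expr1 (mul1r, mulN1r). Qed.

Lemma angle_lt j : angle j < angle j.+1.
Proof.
have e : j.+1%:R = j%:R + 1 :> R by rewrite natr1.
rewrite /angle /= e; move: dlt0 dlth => ? ?.
case: (odd j) => /=; rewrite addr0.
  by case: (sign_cases (shift_sign (j %% n)./2) dlt) => ->; lra.
by case: (sign_cases (shift_sign (j.+1 %% n)./2) dlt) => ->; lra.
Qed.

Lemma angle_half j : angle (j + n) = angle j + pi.
Proof.
have e : (j + n)%:R * h = j%:R * h + pi by rewrite natrD mulrDl nh.
rewrite /angle e modnDr oddD.
by rewrite on addbF; case: (odd j); rewrite ?addr0; lra.
Qed.

Lemma moves_half j : moves (j + n) = ~~ moves j.
Proof.
rewrite /moves modnDr divnDr ?dvdnn// divnn n0 addn1 /= oddD on addbF.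
by rewrite addbN.
Qed.

Lemma walk_step j : walk j.+1 =
  walk j + (if moves j then dir (angle j.+1) - dir (angle j) else 0).
Proof.
by rewrite /walk !big_nat_recr//=; case: (moves j).
Qed.

Lemma moves_pair K : moves K.*2.+1 = ~~ moves K.*2.
Proof.
have e : (K.*2 = (K %/ q.*2) * n + (K %% q.*2).*2)%N.
  by rewrite {1}(divn_eq K q.*2) nE; lia.
have lm : (K %% q.*2 < q.*2)%N by rewrite ltn_mod; lia.
have lt : ((K %% q.*2).*2.+1 < n)%N by lia.
have m0 : (K.*2 %% n = (K %% q.*2).*2)%N by rewrite {1}e modnMDl modn_small ?(ltnW lt)//.
have m1 : (K.*2.+1 %% n = (K %% q.*2).*2.+1)%N by rewrite {1}e -addnS modnMDl modn_small.
have d0 : (K.*2 %/ n = K %/ q.*2)%N by rewrite {1}e divnMDl// (divn_small (ltnW lt)) addn0.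
have d1 : (K.*2.+1 %/ n = K %/ q.*2)%N by rewrite {1}e -addnS divnMDl// (divn_small lt) addn0.
rewrite /moves m0 m1 d0 d1 /= odd_double uphalf_double doubleK.
by case: (pair_sign _); case: (odd _).
Qed.

(** The two steps of a pair carry opposite signs, so each pair collapses to a signed second
    difference of [g]. *)
Lemma pair_contrib (g : R -> R) :
  \sum_(0 <= m < n) (-1) ^+ (~~ moves m) * (g (angle m.+1) - g (angle m)) =
  \sum_(0 <= K < q.*2) (-1) ^+ pair_sign K *
    (2 * g (angle K.*2.+1) - g (angle K.*2) - g (angle K.*2.+2)).
Proof.
rewrite nE sum_pairs; apply: eq_big_nat => K /andP[_ Kq].
rewrite moves_pair /moves modn_small ?divn_small ?odd_double; [|lia..].
rewrite doubleK addbT addbF negbK.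
by case: (pair_sign K); rewrite ?expr0 ?expr1; ring.
Qed.

Definition pair_center K : R := - (pi / 2) + (2 * K + 1)%:R * h.

Lemma angle_even K : angle K.*2 = pair_center K - h.
Proof.
by rewrite /angle odd_double /pair_center -muln2 natrD !natrM; ring.
Qed.

Lemma pair_centerS K : pair_center K.+1 - h = pair_center K + h.
Proof. by rewrite /pair_center !natrD !natrM -[K.+1%:R]natr1; ring. Qed.

Lemma angle_odd K : (K < q.*2)%N ->
  angle K.*2.+1 = pair_center K + (-1) ^+ shift_sign K * dlt.
Proof.
move=> Kq; rewrite /angle /= odd_double modn_small; last by lia.
have -> : (K.*2.+1)./2 = K by lia.
by have -> : K.*2.+1 = (2 * K + 1)%N by lia.
Qed.

Lemma pair_center_upper k : pair_center (q + k) = (2 * k + 1)%:R * h.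
Proof.
rewrite /pair_center -nh nq.
have -> : (2 * (q + k) + 1)%:R = 2 * q%:R + (2 * k + 1)%:R :> R.
  by rewrite mulnDr -addnA natrD natrM.
by rewrite natrM; lra.
Qed.

Lemma pair_center_mirror k : (k < q)%N ->
  pair_center (q - k.+1) = - pair_center (q + k).
Proof.
move=> kq; rewrite pair_center_upper /pair_center -nh nq.
have -> : (2 * (q - k.+1) + 1 = 2 * q - (2 * k + 1))%N by lia.
by rewrite natrB; [rewrite !natrM; lra|lia].
Qed.

Lemma pair_sign_mirror k : (k < q)%N ->
  pair_sign (q - k.+1) = ~~ pair_sign (q + k).
Proof.
move=> kq; rewrite /pair_sign ifT; last by lia.
by rewrite ifF; [congr (~~ b _); lia|lia].
Qed.

Lemma pair_signE k : pair_sign (q + k) = b k.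
Proof. by rewrite /pair_sign ifF; [congr b|]; lia. Qed.

Lemma shift_signE K : (-1) ^+ shift_sign K = - ((-1) ^+ pair_sign K * (-1) ^+ (S < 0)%R) :> R.
Proof.
by rewrite /shift_sign; case: (pair_sign K); case: (S < 0); rewrite /= ?expr0 ?expr1; ring.
Qed.

Lemma cos_shift x (c : bool) : cos (x + (-1) ^+ c * dlt) =
  cos x * cos dlt - (-1) ^+ c * (sin x * sin dlt).
Proof.
by rewrite cosD; case: c; rewrite ?expr0 ?expr1 ?mul1r ?mulN1r ?cosN ?sinN; ring.
Qed.

Lemma sin_shift x (c : bool) : sin (x + (-1) ^+ c * dlt) =
  sin x * cos dlt + (-1) ^+ c * (cos x * sin dlt).
Proof.
by rewrite sinD; case: c; rewrite ?expr0 ?expr1 ?mul1r ?mulN1r ?cosN ?sinN; ring.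
Qed.

Lemma closed_cos :
  \sum_(0 <= m < n) (-1) ^+ (~~ moves m) * (cos (angle m.+1) - cos (angle m)) = 0.
Proof.
rewrite pair_contrib sum_mirror big1_seq//= => k; rewrite mem_index_iota => /andP[_ kq].
rewrite -!doubleS !angle_even !angle_odd; [|lia..].
rewrite !pair_centerS.
rewrite pair_center_mirror// !cos_shift !shift_signE pair_sign_mirror//.
move: (pair_center _) ((-1) ^+ (S < 0)%R) => x e.
rewrite !cosD !(sinN, cosN).
by case: (pair_sign _); rewrite /= ?expr0 ?expr1; ring.
Qed.

Lemma closed_sin :
  \sum_(0 <= m < n) (-1) ^+ (~~ moves m) * (sin (angle m.+1) - sin (angle m)) = 0.
Proof.
rewrite pair_contrib sum_mirror.
transitivity (\sum_(0 <= k < q) (4 * (cos dlt - cos h) * ((-1) ^+ b k * sin ((2 * k + 1)%:R * h))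
  - 4 * (-1) ^+ (S < 0)%R * sin dlt * cos ((2 * k + 1)%:R * h))).
  apply: eq_big_nat => k /andP[_ kq].
  rewrite -!doubleS !angle_even !angle_odd; [|lia..].
  rewrite !pair_centerS.
  rewrite pair_center_mirror// !sin_shift !shift_signE pair_sign_mirror//.
  rewrite pair_signE pair_center_upper; move: (_ * h) ((-1) ^+ (S < 0)%R) => x e.
  rewrite !sinD !(sinN, cosN).
  by case: (b k); rewrite /= ?expr0 ?expr1; ring.
rewrite sumrB -!mulr_sumr -SE -TE.
have SE' : S = (-1) ^+ (S < 0)%R * `|S|.
  have [s|s] := ltP S 0; rewrite /= ?expr0 ?expr1.
    by rewrite ltr0_norm//; ring.
  by rewrite ger0_norm//; ring.
rewrite {1}SE'; move: ((-1) ^+ (S < 0)%R) => e.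
have -> : 4 * (cos dlt - cos h) * (e * `|S|) - 4 * e * sin dlt * T =
  4 * e * (`|S| * (cos dlt - cos h) - sin dlt * T) by ring.
by rewrite dltE subrr mulr0.
Qed.

(** The indicator of a move is half of one plus its sign: the constant part telescopes and the
    signed part vanishes by hypothesis. *)
Lemma half_walk (g : R -> R) :
  \sum_(0 <= m < n) (-1) ^+ (~~ moves m) * (g (angle m.+1) - g (angle m)) = 0 ->
  g (angle n) = - g (angle 0) ->
  \sum_(0 <= m < n) (if moves m then g (angle m.+1) - g (angle m) else 0) = - g (angle 0).
Proof.
move=> c0 gn; apply: (@mulfI _ 2); first by rewrite pnatr_eq0.
have := telescope_sumr (g \o angle) (leq0n n); rewrite /= gn => tel.
transitivity (\sum_(0 <= m < n) (g (angle m.+1) - g (angle m)) +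
  \sum_(0 <= m < n) (-1) ^+ (~~ moves m) * (g (angle m.+1) - g (angle m))).
  rewrite mulr_sumr -big_split/=; apply: eq_bigr => m _.
  by case: (moves m); rewrite /= ?expr0 ?expr1; ring.
by rewrite c0 tel; ring.
Qed.

Lemma walk_half : walk 0 - walk n = dir (angle 0).
Proof.
have an : angle n = angle 0 + pi by rewrite -angle_half.
rewrite /walk !half_walk ?closed_cos ?closed_sin ?an ?cosDpi ?sinDpi//.
by rewrite !big_nil /dir; congr pair; rewrite /= sub0r opprK.
Qed.

Lemma gap_even K : (K < q.*2)%N -> gap angle K.*2 = h + (-1) ^+ shift_sign K * dlt.
Proof. by move=> Kq; rewrite /gap angle_odd// angle_even; ring. Qed.

Lemma gap_odd K : (K < q.*2)%N -> gap angle K.*2.+1 = h - (-1) ^+ shift_sign K * dlt.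
Proof.
by move=> Kq; rewrite /gap angle_odd// -doubleS angle_even pair_centerS; ring.
Qed.

(** Half a turn later the other step of the pair moves, and the two gaps of a pair are [h + dlt] and
    [h - dlt]. *)
Lemma gap_side_pair K : (K < q.*2)%N -> exists c : bool,
  gap angle (side_index moves K) = h + (-1) ^+ c * dlt /\
  gap angle (side_index moves (K + q.*2)) = h - (-1) ^+ c * dlt.
Proof.
move=> Kq; have -> : side_index moves (K + q.*2) =
    ((if moves K.*2 then K.*2.+1 else K.*2) + n)%N.
  by rewrite /side_index doubleD -nE moves_half; case: (moves _) => /=; lia.
rewrite (gap_half angle_half) /side_index; case: ifP => _.
  by exists (shift_sign K); rewrite gap_even// gap_odd.
exists (~~ shift_sign K); rewrite gap_even// gap_odd//.
by case: (shift_sign K); rewrite /= ?expr0 ?expr1; split; ring.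
Qed.

Lemma polygon_of_signs : exists P : polygon R n,
  [/\ convex_polygon P, small P,
      perimeter P = 2 * n%:R * sin (pi / (2 * n%:R)) * cos (dlt / 2)
    & width P = cos (pi / (2 * n%:R) + dlt / 2)].
Proof.
have h0 : 0 < h by exact: lt_trans dlt0 dlth.
move: dlt0 dlth => d0 dh.
have hh : pi / (2 * n%:R) = h / 2 :> R.
  by rewrite hE; field; rewrite pnatr_eq0; lia.
exists (@even_vertices R n walk); split.
- exact: (even_vertices_convex angle_lt angle_half moves_half walk_step walk_half moves_pair).
- apply: (even_vertices_small angle_lt angle_half moves_half walk_step walk_half).
    by rewrite nE odd_double.
  by rewrite /angle /= mul0r !addr0.
- rewrite (even_vertices_perimeter angle_lt angle_half moves_half walk_step walk_half moves_pair).
  rewrite -(big_mkord xpredT (fun i => 2 * sin (gap angle (side_index moves i) / 2))).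
  rewrite hh [in LHS]nE sum_halves.
  (* Two opposite sides add up to [2 sin ((h + dlt) / 2) + 2 sin ((h - dlt) / 2) = 4 sin (h / 2) cos
     (dlt / 2)]. *)
  rewrite (eq_big_nat _ _ (F2 := fun=> 4 * sin (h / 2) * cos (dlt / 2))).
    have -> : n%:R = 2 * (q.*2)%:R :> R by rewrite nE -[in LHS]muln2 natrM mulrC.
    by rewrite sumr_const_nat subn0 -mulr_natl; ring.
  move=> K /andP[_ Kq]; have [c [-> ->]] := gap_side_pair Kq.
  rewrite !mulrDl mulNr !sinD !cosN !sinN.
  by case: c; rewrite ?expr0 ?expr1 ?mulN1r ?mul1r ?mulNr ?cosN ?sinN; ring.
have heightE := even_vertices_height angle_lt angle_half moves_half walk_step walk_half moves_pair.
have hpi : h + dlt <= pi.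
  have : n%:R * h = pi by [].
  have : 4 <= n%:R :> R by rewrite ler_nat nq; lia.
  by nra.
have gapE (i : 'I_n) : exists c : bool, gap angle (side_index moves i) = h + (-1) ^+ c * dlt.
  have [iq|iq] := ltnP i q.*2.
    by have [c [? _]] := gap_side_pair iq; exists c.
  have iq' : (i - q.*2 < q.*2)%N by have := ltn_ord i; rewrite {2}nE; lia.
  have [c [_ e]] := gap_side_pair iq'; exists (~~ c); rewrite subnK in e => //.
  by rewrite e; case: c {e}; rewrite /= ?expr0 ?expr1; ring.
have lt0q : (0 < q.*2)%N by lia.
rewrite /width hh; apply: inf_attained; last first.
  move=> _ [i _ <-]; rewrite heightE; have [c ->] := gapE i.
  have ? : - dlt <= (-1) ^+ c * dlt <= dlt by case: (sign_cases c dlt) => ->; lra.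
  rewrite leNgt ltr_cos ?in_itv/=; try lra.
(* The wide gap [h + dlt] gives the least height; it occurs at side 0 or at the opposite side. *)
have [c [e0 e1]] := gap_side_pair lt0q.
have ltn : (q.*2 < n)%N by rewrite nE; lia.
case: c e0 e1; rewrite ?expr0 ?expr1 => e0 e1.
  exists (Ordinal ltn) => //; rewrite heightE /= -[q.*2]add0n e1; congr cos; lra.
by exists (Ordinal n0) => //; rewrite heightE /= e0; congr cos; lra.
Qed.

End Construction.

(** * Signed sums of sines do not vanish *)

Section NonVanishing.
Set Implicit Arguments.
Unset Strict Implicit.

(** The quotient [sin ((2k + 1) h) / sin h] as a polynomial in [2 cos (2h)]: Chebyshev polynomials
    of the fourth kind, rescaled to be monic. *)
Fixpoint sine_poly (k : nat) : {poly int} :=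
  match k with
  | 0 => 1
  | k'.+1 => match k' with
             | 0 => 'X + 1
             | k''.+1 => 'X * sine_poly k' - sine_poly k''
             end
  end.

Lemma sine_polySS k : sine_poly k.+2 = 'X * sine_poly k.+1 - sine_poly k.
Proof. by []. Qed.

Lemma sine_poly_monic k : (sine_poly k \is monic) /\ size (sine_poly k) = k.+1.
Proof.
suff [? _] : (sine_poly k \is monic /\ size (sine_poly k) = k.+1) /\
  (sine_poly k.+1 \is monic /\ size (sine_poly k.+1) = k.+2) by [].
elim: k => [|k [[mk sk] [mk1 sk1]]].
  by rewrite /= monic1 size_poly1 -(opprK 1) -polyCN monicXsubC size_XsubC.
split=> //; rewrite sine_polySS.
have sX : size ('X * sine_poly k.+1) = k.+3.
  by rewrite mulrC size_mulX ?sk1// monic_neq0.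
have lt : (size (- sine_poly k) < size ('X * sine_poly k.+1)%R)%N.
  by rewrite sX size_polyN sk; lia.
split; last by rewrite size_polyDl.
by rewrite monicE lead_coefDl// lead_coefM lead_coefX mul1r -monicE.
Qed.

Definition signed_sine_poly (b : nat -> bool) (q : nat) : {poly int} :=
  \sum_(0 <= k < q) (-1) ^+ b k *: sine_poly k.

Lemma size_signed_sine_poly b q : size (signed_sine_poly b q) = q.
Proof.
rewrite /signed_sine_poly; elim: q => [|q IH]; first by rewrite big_nil size_poly0.
rewrite big_nat_recr//= addrC size_polyDl.
  by rewrite size_scale ?signr_eq0// (sine_poly_monic q).2.
by rewrite IH size_scale ?signr_eq0// (sine_poly_monic q).2.
Qed.

(** Iterates of the doubling formula for [2 cos]; the degree is [2 ^ m]. *)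
Fixpoint cheb_poly (m : nat) : {poly int} :=
  if m is m'.+1 then cheb_poly m' ^+ 2 - 2%:P else 'X.

Lemma cheb_poly_mod2 m : exists r : {poly int}, cheb_poly m = 'X^(2 ^ m) + 2 *: r.
Proof.
elim: m => [|m [r E]]; first by exists 0; rewrite scaler0 addr0.
exists (2 *: ('X^(2 ^ m) * r) + 2 *: r ^+ 2 - 1).
rewrite /= E sqrrD -exprM -expnSr -!addrA; congr (_ + _).
rewrite -!mul_polyC; have -> : (2 : int)%:P = 1 + 1 :> {poly int} by rewrite -polyCD.
by ring.
Qed.

Lemma cheb_poly_monic m : cheb_poly m \is monic /\ size (cheb_poly m) = (2 ^ m).+1.
Proof.
elim: m => [|m [mm sm]]; first by rewrite monicX size_polyX.
have s2 : size (cheb_poly m ^+ 2) = (2 ^ m.+1).+1.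
  by rewrite expr2 size_monicM ?monic_neq0// sm expnS; lia.
have lt : (size (- (2 : int)%:P)%R < size (cheb_poly m ^+ 2)%R)%N.
  by rewrite s2 size_polyN size_polyC /= ltnS expn_gt0.
split; last by rewrite /= size_polyDl.
by rewrite monicE /= lead_coefDl// -monicE monic_exp.
Qed.

(** Eisenstein at 2: modulo 2 only the leading term survives, and the constant term is an even
    square minus 2, hence not divisible by 4. *)
Lemma cheb_poly_irreducible m : (0 < m)%N -> irreducible_poly (cheb_poly m).
Proof.
case: m => // m _; have [mon siz] := cheb_poly_monic m.+1.
apply: (@eisenstein_crit 2) => //.
- by rewrite siz eqSS expn_eq0.
- by rewrite (monicP mon).
- rewrite /= coefB coefC /=.
  rewrite -horner_coef0 horner_exp; set c := (cheb_poly m).[0].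
  have [d ->] : exists d, c = 2 * d.
    have [r E] := cheb_poly_mod2 m; exists r.[0].
    by rewrite /c E hornerD hornerXn hornerZ expr0n /= expn_eq0 /= add0r.
  apply/negP => /dvdzP[k]; lia.
move=> i; rewrite siz /= => il; have [r E] := cheb_poly_mod2 m.+1.
rewrite -/(cheb_poly m.+1) E coefD coefXn coefZ ltn_eqF// add0r.
by rewrite dvdz_mulr.
Qed.

Variable R : realType.

Lemma horner_sine_poly k (h : R) :
  (map_poly intr (sine_poly k)).[2 * cos (2 * h)] * sin h = sin ((2 * k + 1)%:R * h).
Proof.
suff [? _] : (map_poly intr (sine_poly k)).[2 * cos (2 * h)] * sin h
    = sin ((2 * k + 1)%:R * h) /\ (map_poly intr (sine_poly k.+1)).[2 * cos (2 * h)] * sin h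
    = sin ((2 * k.+1 + 1)%:R * h) by [].
have step (x : R) : sin (x + 2 * h) = 2 * cos (2 * h) * sin x - sin (x - 2 * h).
  by rewrite sinD sinB; ring.
elim: k => [|k [IH0 IH1]].
  split; first by rewrite rmorph1 hornerC mul1r muln0 add0n mul1r.
  rewrite [sine_poly 1]/= (rmorphD (map_poly intr)) /= map_polyX rmorph1.
  rewrite hornerD hornerX hornerC.
  have -> : (2 * 1 + 1)%:R * h = h + 2 * h by rewrite muln1 natrD; ring.
  rewrite step; have -> : h - 2 * h = - h by ring.
  by rewrite sinN; ring.
split=> //; rewrite sine_polySS rmorphB rmorphM /= map_polyX hornerD hornerN hornerM hornerX.
rewrite mulrBl -mulrA IH0 IH1.
have -> : (2 * k.+2 + 1)%:R * h = (2 * k.+1 + 1)%:R * h + 2 * h.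
  have -> : (2 * k.+2 + 1 = 2 * k.+1 + 1 + 2)%N by lia.
  by rewrite natrD mulrDl.
rewrite step; congr (_ - sin _).
have -> : (2 * k.+1 + 1 = 2 * k + 1 + 2)%N by lia.
by rewrite (natrD _ (2 * k + 1)) mulrDl addrK.
Qed.

Lemma horner_cheb_poly m (x : R) :
  (map_poly intr (cheb_poly m)).[2 * cos x] = 2 * cos ((2 ^ m)%:R * x).
Proof.
elim: m => [|m IH]; first by rewrite map_polyX hornerX mul1r.
rewrite /= rmorphB rmorphXn /= map_polyC hornerD hornerN horner_exp hornerC IH.
have -> : (2 ^ m.+1)%:R * x = ((2 ^ m)%:R * x) *+ 2.
  by rewrite expnS natrM -mulrA mulr_natl.
by rewrite cos_mulr2n; ring.
Qed.

(** Divided by [sin h], the sum is the value at [2 cos (2h)] of a polynomial of degree [q - 1], too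
    small to share a root with the irreducible polynomial of degree [q] that vanishes there. *)
Lemma signed_sines_neq0 s (b : nat -> bool) : (3 <= s)%N ->
  \sum_(0 <= k < 2 ^ (s - 2)) (-1) ^+ b k * sin ((2 * k + 1)%:R * (pi / (2 ^ s)%:R)) != 0 :> R.
Proof.
move=> s3; set h := pi / _; set q := (2 ^ (s - 2))%N.
have s0 : (2 ^ s)%:R != 0 :> R by rewrite pnatr_eq0 expn_eq0.
have m0 : (0 < s - 2)%N by lia.
pose f := map_poly (intr : int -> rat) (signed_sine_poly b q).
pose g := map_poly (intr : int -> rat) (cheb_poly (s - 2)).
have q0 : (0 < q)%N by rewrite expn_gt0.
have intr_inj_rat : injective (intr : int -> rat) by exact: intr_inj.
have sf : size f = q by rewrite size_map_inj_poly ?rmorph0// size_signed_sine_poly.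
have sg : size g = q.+1 by rewrite size_map_inj_poly ?rmorph0// (cheb_poly_monic _).2.
have fg : coprimep g f.
  rewrite irreducible_poly_coprime; last exact/irreducible_rat_int/cheb_poly_irreducible.
  have f0 : f != 0 by rewrite -size_poly_gt0 sf.
  by apply/negP => /(dvdp_leq f0); rewrite sf sg ltnn.
have ratr_intr p : map_poly (ratr : rat -> R) (map_poly (intr : int -> rat) p) = map_poly intr p.
  by rewrite -map_poly_comp; apply: eq_map_poly => z /=; rewrite ratr_int.
have root_g : root (map_poly (ratr : rat -> R) g) (2 * cos (2 * h)).
  rewrite /root ratr_intr horner_cheb_poly.
  have -> : (2 ^ (s - 2))%:R * (2 * h) = pi / 2.
    have sE : (2 ^ s = 2 ^ (s - 2) * 4)%N by rewrite -{1}(subnK (ltnW s3)) expnD.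
    move: s0; rewrite /h sE natrM mulf_eq0 negb_or => /andP[? ?]; by field.
  by rewrite cos_pihalf mulr0.
have := coprimep_root (etrans (coprimep_map _ g f) fg) root_g.
rewrite ratr_intr; apply: contraNneq => E.
have sh : sin h != 0.
  rewrite gt_eqF// sin_gt0_pi// divr_gt0 ?pi_gt0 ?ltr0n ?expn_gt0//=.
  rewrite ltr_pdivrMr ?ltr0n ?expn_gt0// ltr_pMr ?pi_gt0// ltr1n.
  by rewrite -{1}(expn0 2) ltn_exp2l//; lia.
apply/eqP/(mulIf sh); rewrite mul0r -E.
rewrite /signed_sine_poly rmorph_sum horner_sum mulr_suml.
apply: eq_bigr => k _; rewrite -horner_sine_poly /= map_polyZ hornerZ.
by rewrite rmorphXn rmorphN1 -mulrA.
Qed.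

End NonVanishing.

(** * The equation defining delta *)

Section Delta.
Import numFieldNormedType.Exports.
Set Implicit Arguments.
Unset Strict Implicit.
Variable R : realType.

Lemma sin_MVT (x : R) : 0 < x -> exists2 c, 0 < c < x & sin x = x * cos c.
Proof.
move=> x0.
have drv y : y \in `]0, x[%R -> is_derive y 1 sin (cos y) by move=> _; exact: is_derive_sin.
have cont : {within `[0, x], continuous (@sin R)}%classic.
  by apply: continuous_subspaceT => y; exact: continuous_sin.
have [c cx e] := MVT x0 drv cont.
exists c; first by move: cx; rewrite in_itv.
by move: e; rewrite sin0 !subr0 mulrC.
Qed.

Lemma sin_le_id (x : R) : 0 <= x -> sin x <= x.
Proof.
rewrite le_eqVlt => /predU1P[<-|x0]; first by rewrite sin0.
by have [c _ ->] := sin_MVT x0; rewrite ger_pMr// cos_le1.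
Qed.

Lemma sin_ge_cos1 (x : R) : 0 <= x <= 1 -> x * cos 1 <= sin x.
Proof.
case/andP; rewrite le_eqVlt => /predU1P[<-|x0 x1]; first by rewrite sin0 mul0r.
have [c cx ->] := sin_MVT x0; rewrite ler_pM2l// ltW// ltr_cos ?in_itv/=; [lra| |].
  by have := @pi_ge2 R; lra.
by have := @pi_ge2 R; lra.
Qed.

Variables (sg h : R).
Hypotheses (sg0 : 0 < sg) (h0 : 0 < h) (hpi : h < pi / 2).

(** With [r = sqrt (1 + sg^2)] one has [sg cos x - sin x = r cos (x + tilt)], which turns the
    equation into [cos (x + tilt) = cos tilt cos h]. *)
Definition tilt : R := acos (sg / Num.sqrt (1 + sg ^+ 2)).

Definition tilt_gap : R := acos (sg / Num.sqrt (1 + sg ^+ 2) * cos h) - tilt.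

Let r : R := Num.sqrt (1 + sg ^+ 2).

Let r2 : r ^+ 2 = 1 + sg ^+ 2.
Proof. by rewrite sqr_sqrtr// addr_ge0// sqr_ge0. Qed.

Let r0 : 0 < r.
Proof. by rewrite sqrtr_gt0 ltr_wpDr ?sqr_ge0. Qed.

Let sgr : 0 < sg / r < 1.
Proof.
rewrite divr_gt0//= ltr_pdivrMr// mul1r -(@ltr_pXn2r _ 2)// ?nnegrE ?ltW//.
by rewrite r2 ltrDr.
Qed.

Lemma cos_tilt : cos tilt = sg / r.
Proof. by rewrite acosK// in_itv/=; move: sgr; lra. Qed.

Lemma sin_tilt : sin tilt = r^-1.
Proof.
rewrite sin_acos; last by move: sgr; lra.
have -> : 1 - (sg / Num.sqrt (1 + sg ^+ 2)) ^+ 2 = r ^- 2.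
  rewrite expr_div_n -/r; apply: (@mulIf _ (r ^+ 2)); first by rewrite sqrf_eq0 gt_eqF.
  by rewrite mulrBl divfK ?sqrf_eq0 ?gt_eqF// mulVf ?sqrf_eq0 ?gt_eqF// r2; ring.
by rewrite -exprVn sqrtr_sqr ger0_norm// invr_ge0 ltW.
Qed.

Lemma tilt_bounds : 0 < tilt < pi / 2.
Proof.
have sr := sgr; have pi0 := @pi_gt0 R.
rewrite acos_gt0 /=; last by rewrite -/r; lra.
rewrite ltNge; apply/negP => le2.
have tp : tilt <= pi by apply: acos_lepi; rewrite -/r; lra.
have : cos tilt <= cos (pi / 2) by rewrite leNgt ltr_cos -?leNgt// in_itv/=; lra.
by rewrite cos_pihalf cos_tilt; lra.
Qed.

Lemma cosD_tilt x : cos (x + tilt) = (sg * cos x - sin x) / r.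
Proof. by rewrite cosD cos_tilt sin_tilt; ring. Qed.

Lemma tilt_eqP x : sg * (cos x - cos h) = sin x <-> cos (x + tilt) = sg / r * cos h.
Proof.
rewrite cosD_tilt mulrAC; split=> [e|/(mulIf _) e].
  by congr (_ / _); rewrite -e; ring.
by rewrite mulrBr -e ?invr_eq0 ?gt_eqF//; ring.
Qed.

Let cosh : 0 < cos h < 1.
Proof.
have pi0 := @pi_gt0 R; move: h0 hpi => h1 h2.
rewrite cos_gt0_pihalf; last lra.
by rewrite -[X in _ < X]cos0 ltr_cos ?in_itv/=; lra.
Qed.

Let cos_gapD : cos (tilt_gap + tilt) = sg / r * cos h.
Proof.
rewrite subrK acosK// in_itv/= -/r; have := sgr; have := cosh.
by move: (sg / r) (cos h) => u v *; nra.
Qed.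

Let gapD_bounds : 0 <= tilt_gap + tilt <= pi.
Proof.
have ? : -1 <= sg / r * cos h <= 1.
  have := sgr; have := cosh.
  by move: (sg / r) (cos h) => u v *; nra.
by rewrite subrK acos_ge0 ?acos_lepi.
Qed.

(** The cosine decreases on [[0, pi]], so it suffices to compare its values at [tilt],
    [tilt_gap + tilt] and [h + tilt]. *)
Lemma tilt_gap_bounds : 0 < tilt_gap < h.
Proof.
have tb := tilt_bounds; have cb := cosh; have sb := sgr; have gb := gapD_bounds.
have pi0 := @pi_gt0 R; move: h0 hpi => h1 h2.
apply/andP; split.
  rewrite -(ltrD2r tilt) add0r -ltr_cos ?in_itv/=; [|lra|lra].
  rewrite cos_gapD cos_tilt.
  by move: cb sb; move: (sg / r) (cos h) => u v *; nra.
rewrite -(ltrD2r tilt) -ltr_cos ?in_itv/=; [|lra|lra].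
rewrite cos_gapD cosD_tilt mulrAC ltr_pM2r ?invr_gt0// gtrBl.
by rewrite sin_gt0_pi//; lra.
Qed.

Lemma tilt_gapE : sg * (cos tilt_gap - cos h) = sin tilt_gap.
Proof. exact/tilt_eqP/cos_gapD. Qed.

Lemma tilt_gap_unique x : 0 < x < h -> sg * (cos x - cos h) = sin x -> x = tilt_gap.
Proof.
move=> xb /tilt_eqP; rewrite -cos_gapD => e.
have tb := tilt_bounds; have gb := gapD_bounds; move: h0 hpi => h1 h2.
by apply: (addIr tilt); apply: cos_inj e; rewrite in_itv/=; lra.
Qed.

(** Indeed [tilt_gap cos 1 <= sin tilt_gap = sg (cos tilt_gap - cos h) <= sg]. *)
Lemma tilt_gap_le : h <= 1 -> tilt_gap <= sg / cos 1.
Proof.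
move=> hle1; have /andP[d0 dh] := tilt_gap_bounds.
rewrite ler_pdivlMr ?cos1_gt0//; apply: le_trans (sin_ge_cos1 _) _; first lra.
rewrite -tilt_gapE ger_pMr//; have := cos_le1 tilt_gap; have := cosh; lra.
Qed.

End Delta.

(** * Combinations of equally spaced samples of a sine *)

Section Combs.
Set Implicit Arguments.
Unset Strict Implicit.
Variable R : realType.

Definition sgval (o : option bool) : R := if o is Some c then (-1) ^+ c else 0.

Definition sgmul (o o' : option bool) : option bool :=
  if o is Some c then if o' is Some c' then Some (c (+) c') else None else None.

Lemma sgvalM o o' : sgval (sgmul o o') = sgval o * sgval o'.
Proof.
case: o => [c|]; case: o' => [c'|]; rewrite /= ?mul0r ?mulr0//.
by rewrite signr_addb.
Qed.

Lemma sum_blocks (V : zmodType) (F : nat -> V) a b :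
  \sum_(0 <= l < a * b) F l = \sum_(0 <= i < b) \sum_(0 <= k < a) F (k + a * i)%N.
Proof.
elim: b => [|b IH]; first by rewrite muln0 !big_nil.
rewrite mulnS addnC (@big_cat_nat _ _ _ (a * b)) ?leq_addr//= big_nat_recr//= IH.
congr (_ + _); rewrite -{1}[(a * b)%N]add0n big_addn addKn.
by apply: eq_bigr.
Qed.

(* [P l] is the coefficient of the sample [l]: [None] means 0, so that the sample
   stays available for another combination. *)
Definition comb (y : R) (m : nat) (P : nat -> option bool) (A th : R) : Prop :=
  forall phi, \sum_(0 <= l < 2 ^ m) sgval (P l) * sin (phi + (2 * l)%:R * y) =
    A * sin (phi + th).

(** Write [l = k + 2^j i]. Summing over [k] turns each block into [A] times a sine, and [c] combines
    these sines, whose step is [2^j] times larger. *)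
Lemma comb_mul y j P A th w c B th' : comb y j P A th ->
  comb ((2 ^ j)%:R * y) w c B th' ->
  comb y (j + w) (fun l => sgmul (P (l %% 2 ^ j)%N) (c (l %/ 2 ^ j)%N)) (A * B) (th + th').
Proof.
move=> hP hc phi; rewrite expnD sum_blocks.
have e2 : (0 < 2 ^ j)%N by rewrite expn_gt0.
transitivity (\sum_(0 <= i < 2 ^ w) sgval (c i) *
    (A * sin (phi + th + (2 * i)%:R * ((2 ^ j)%:R * y)))).
  apply: eq_bigr => i _.
  have -> : phi + th + (2 * i)%:R * ((2 ^ j)%:R * y) =
    phi + (2 * i)%:R * ((2 ^ j)%:R * y) + th by ring.
  rewrite -hP mulr_sumr; apply: eq_big_nat => k /andP[_ kj].
  have -> : ((k + 2 ^ j * i) %% 2 ^ j = k)%N.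
    by rewrite addnC mulnC modnMDl modn_small.
  have -> : ((k + 2 ^ j * i) %/ 2 ^ j = i)%N.
    by rewrite addnC mulnC divnMDl// divn_small// addn0.
  rewrite sgvalM.
  rewrite mulrA [sgval (c i) * _]mulrC; congr (_ * sin _).
  by rewrite mulnDr natrD !natrM; ring.
have -> : phi + (th + th') = phi + th + th' by ring.
rewrite -mulrA -hc mulr_sumr; apply: eq_bigr => i _; ring.
Qed.

Lemma comb_pad y j j' P A th : (j <= j')%N -> comb y j P A th ->
  comb y j' (fun l => if (l < 2 ^ j)%N then P l else None) A th.
Proof.
move=> jj hP phi; rewrite (@big_cat_nat _ _ _ (2 ^ j))//= ?leq_exp2l//.
rewrite [X in _ + X]big1_seq ?addr0; last first.
  by move=> l; rewrite mem_index_iota /= => /andP[l1 _]; rewrite ltnNge l1/= mul0r.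
by rewrite -hP; apply: eq_big_nat => l /andP[_ ->].
Qed.

Lemma comb_one y : comb y 0 (fun=> Some false) 1 0.
Proof.
by move=> phi; rewrite expn0 big_nat1 /= muln0 mul0r expr0.
Qed.

Fixpoint subz (p q : seq int) : seq int :=
  match p, q with
  | [::], _ => [seq - z | z <- q]
  | _, [::] => p
  | x :: p', z :: q' => (x - z) :: subz p' q'
  end.

Lemma nth_subz p q l : nth 0 (subz p q) l = nth 0 p l - nth 0 q l.
Proof.
elim: p q l => [|x p IH] [|z q] [|l] //=; rewrite ?subr0 ?sub0r ?nth_nil//.
by have [lq|lq] := ltnP l (size q); [rewrite (nth_map 0)|rewrite !nth_default ?size_map ?oppr0].
Qed.

(** The coefficients of the product of the [1 - X^a], as an integer list so that a concrete product
    can be checked by computation. *)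
Fixpoint prod_coefs (s : seq nat) : seq int :=
  if s is a :: s' then let p := prod_coefs s' in subz p (nseq a 0 ++ p)
  else [:: 1].

Lemma nth_shift (p : seq int) a l :
  nth 0 (nseq a 0 ++ p) l = if (a <= l)%N then nth 0 p (l - a)%N else 0.
Proof. by rewrite nth_cat size_nseq nth_nseq; case: ltnP => // ->. Qed.

Definition window (s : seq nat) (y : R) : R := \prod_(a <- s) (2 * sin (a%:R * y)).

(** A factor [1 - X^a] acts by [sin u - sin (u + 2ay) = 2 sin (ay) sin (u + ay - pi/2)]. *)
Lemma prod_coefs_sum s (y phi : R) N : (sumn s < N)%N ->
  \sum_(0 <= l < N) (nth 0 (prod_coefs s) l)%:~R * sin (phi + (2 * l)%:R * y) =
  window s y * sin (phi + (sumn s)%:R * y - (size s)%:R * (pi / 2)).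
Proof.
elim: s N phi => [|a s IH] N phi /= aN.
  rewrite /window big_nil mul1r !mul0r subr0 addr0.
  case: N aN => // N _; rewrite big_nat_recl//= mulr1z mul1r muln0 mul0r addr0.
  by rewrite big1 ?addr0// => i _; rewrite nth_nil mul0r.
rewrite (eq_bigr (fun l => (nth 0 (prod_coefs s) l)%:~R * sin (phi + (2 * l)%:R * y) -
   (if (a <= l)%N then nth 0 (prod_coefs s) (l - a)%N else 0)%:~R * sin (phi + (2 * l)%:R * y))); last first.
  by move=> l _; rewrite nth_subz nth_shift intrB mulrBl.
rewrite sumrB IH; last by lia.
have -> : \sum_(0 <= l < N) (if (a <= l)%N then nth 0 (prod_coefs s) (l - a)%N else 0)%:~R
      * sin (phi + (2 * l)%:R * y) =
    \sum_(0 <= l < N - a) (nth 0 (prod_coefs s) l)%:~R * sin (phi + (2 * a)%:R * y + (2 * l)%:R * y).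
  rewrite (@big_cat_nat _ _ _ a)//=; last by lia.
  rewrite [X in X + _]big1_seq ?add0r; last first.
    by move=> l; rewrite mem_index_iota /= => la; rewrite leqNgt la/= mul0r.
  rewrite -{1}[a]add0n big_addn; apply: eq_bigr => l _.
  rewrite leq_addl addnK; congr (_ * sin _).
  by rewrite mulnDr natrD; ring.
rewrite IH; last by lia.
rewrite /window big_cons -/(window s y) (natrD _ a) -[(size s).+1%:R]natr1.
set W := window s y; set S := (sumn s)%:R; set e := (size s)%:R.
pose x := phi + S * y - e * (pi / 2) + a%:R * y.
have -> : phi + S * y - e * (pi / 2) = x - a%:R * y by rewrite /x; ring.
have -> : phi + (2 * a)%:R * y + S * y - e * (pi / 2) = x + a%:R * y.
  by rewrite /x natrM; ring.
have -> : phi + (a%:R + S) * y - (e + 1) * (pi / 2) = x - pi / 2 by rewrite /x; ring.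
by rewrite sinBpihalf sinB sinD; ring.
Qed.

End Combs.

(** * Amplitudes of product combinations *)

Section Window.
Set Implicit Arguments.
Unset Strict Implicit.
Variable R : realType.

Lemma window_gt0 (s : seq nat) w (y : R) : all (fun a => 0 < a < 2 ^ w)%N s ->
  0 < y -> (2 ^ w)%:R * y <= pi -> 0 < window s y.
Proof.
move=> sw y0 yw; rewrite /window big_seq; apply: prodr_gt0 => a /(allP sw)/andP[a0 aw].
rewrite mulr_gt0// sin_gt0_pi// mulr_gt0 ?ltr0n//=.
by apply: lt_le_trans yw; rewrite ltr_pM2r// ltr_nat.
Qed.

(** Factorwise [sin (2u) <= 2 sin u]; this will bound the ratio of neighbouring rungs. *)
Lemma window_double (s : seq nat) w (y : R) : all (fun a => 0 < a < 2 ^ w)%N s ->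
  0 < y -> (2 ^ w)%:R * (2 * y) <= pi -> window s (2 * y) <= 2 ^+ size s * window s y.
Proof.
move=> + y0 yw; elim: s => [|a s IH]; first by rewrite /window !big_nil mulr1.
move=> /[dup] asw /= /andP[/andP[a0 aw] sw]; rewrite /window !big_cons -!/(window _ _).
have ay : a%:R * (2 * y) <= pi.
  by apply: le_trans yw; rewrite ler_pM2r ?mulr_gt0// ler_nat ltnW.
have a0' : 0 < a%:R :> R by rewrite ltr0n.
have ay0 : 0 < a%:R * y by rewrite mulr_gt0.
have -> : 2 ^+ (size s).+1 * (2 * sin (a%:R * y) * window s y) =
  (4 * sin (a%:R * y)) * (2 ^+ size s * window s y) by rewrite exprS; ring.
have e : a%:R * (2 * y) = a%:R * y + a%:R * y by ring.
rewrite e in ay *.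
have s0 : 0 <= sin (a%:R * y) by apply: sin_ge0_pi; lra.
have W0 : 0 < window s (2 * y) by apply: window_gt0 sw _ yw; rewrite mulr_gt0.
apply: ler_pM; [|exact: ltW| |exact: IH].
  by rewrite mulr_ge0// sin_ge0_pi//; lra.
rewrite sinD; have := cos_le1 (a%:R * y); have := cos_geN1 (a%:R * y).
by move: s0; move: (sin _) (cos _) => u v; nra.
Qed.

Lemma window_le (s : seq nat) w (y : R) : all (fun a => 0 < a < 2 ^ w)%N s ->
  0 < y -> (2 ^ w)%:R * y <= pi -> window s y <= ((2 ^ w.+1)%:R * y) ^+ size s.
Proof.
move=> + y0 yw; elim: s => [|a s IH]; first by rewrite /window !big_nil expr0.
move=> /= /andP[/andP[a0 aw] sw]; rewrite /window !big_cons -!/(window _ _) exprS.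
have ay : a%:R * y <= pi.
  by apply: le_trans yw; rewrite ler_pM2r// ler_nat ltnW.
have ay0 : 0 < a%:R * y by rewrite mulr_gt0// ltr0n.
have W0 : 0 < window s y by exact: window_gt0 sw _ yw.
apply: ler_pM; [|exact: ltW| |exact: IH].
  by rewrite mulr_ge0// sin_ge0_pi//; lra.
rewrite expnS natrM -mulrA ler_pM2l//; apply: le_trans (sin_le_id (ltW ay0)) _.
by rewrite ler_pM2r// ler_nat ltnW.
Qed.

Definition window_coef (s : seq nat) (l : nat) : option bool :=
  let z := nth 0 (prod_coefs s) l in
  if z == 0 then None else Some (z == -1).

Lemma comb_window (s : seq nat) w e (y : R) :
  all (fun z : int => (z == 0) || (z == 1) || (z == -1)) (prod_coefs s) ->
  (sumn s < 2 ^ w)%N -> size s = (4 * e)%N ->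
  comb y w (window_coef s) (window s y) ((sumn s)%:R * y).
Proof.
move=> hs sw se phi.
(* The number of factors is a multiple of four, so their quarter turns make whole turns. *)
have -> : sin (phi + (sumn s)%:R * y) =
    sin (phi + (sumn s)%:R * y - (size s)%:R * (pi / 2)).
  rewrite -[RHS](periodicn (@sinD2pi R) e); congr sin.
  by rewrite se -mulrnA -[pi *+ _]mulr_natr !natrM; lra.
rewrite -(prod_coefs_sum _ _ sw); apply: eq_bigr => l _; congr (_ * _).
rewrite /window_coef; set z := nth _ _ _.
have : (z == 0) || (z == 1) || (z == -1).
  have [ls|ls] := ltnP l (size (prod_coefs s)); last by rewrite /z nth_default.
  by have := allP hs _ (mem_nth 0 ls).
by case/orP => [/orP[]|] /eqP ->; rewrite /= ?mulr0z ?mulr1z ?expr0 ?expr1 ?mulrN1z.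
Qed.

End Window.

(** * Greedy choice of signs *)

Section Greedy.
Set Implicit Arguments.
Unset Strict Implicit.
Variable R : realType.

(** Each sign opposes the current sum, whose size then drops by [|v i|] or ends at most [|v i|];
    [D i.+1] dominates both outcomes. *)
Lemma greedy (r0 : R) (v D : nat -> R) M : `|r0| <= D 0%N ->
  (forall i, (i < M)%N -> `|v i| <= D i.+1 /\ D i - `|v i| <= D i.+1) ->
  exists g : nat -> bool, `|r0 + \sum_(0 <= i < M) (-1) ^+ g i * v i| <= D M.
Proof.
elim: M => [|M IH] r00 hD; first by exists (fun=> false); rewrite big_nil addr0.
have [|g hg] := IH r00; first by move=> i iM; apply: hD; lia.
have [v1 v2] := hD M (ltnSn M).
set r := r0 + _ in hg.
have [c hc] : exists c : bool, `|r + (-1) ^+ c * v M| <= D M.+1.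
  exists ((0 <= r) == (0 <= v M)).
  move: hg v1 v2; have [r1|r1] := leP 0 r; have [w1|w1] := leP 0 (v M);
    rewrite /= ?expr0 ?expr1 ?mul1r ?mulN1r ?(ger0_norm r1) ?(ltr0_norm r1)
      ?(ger0_norm w1) ?(ltr0_norm w1) => *; rewrite ler_norml; lra.
exists (fun i => if i == M then c else g i).
rewrite big_nat_recr//= eqxx addrA; move: hc; congr (`|_ + _| <= _).
rewrite /r; congr (_ + _); apply: eq_big_nat => i /andP[_ iM].
by rewrite ltn_eqF.
Qed.

Lemma greedy_unit (x : nat -> R) N : (forall k, `|x k| <= 1) ->
  exists u : nat -> bool, `|\sum_(0 <= k < N) (-1) ^+ u k * x k| <= 1.
Proof.
move=> x1; have [|i _|u] := @greedy 0 x (fun=> 1) N.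
- by rewrite normr0.
- by split=> //; have := normr_ge0 (x i); lra.
by rewrite add0r; exists u.
Qed.

(* [chain P M x x'] : a residue of size [x] can be brought down to [x'] by
   adding or subtracting [M] quantities, each known only to lie in [[a/2, a]]
   for some amplitude [a] in [P]. *)
Inductive chain (P : R -> Prop) : nat -> R -> R -> Prop :=
| chain0 x : chain P 0 x x
| chainS M x x' x'' a : chain P M x x' -> P a -> a <= x'' -> x' - a / 2 <= x'' ->
    chain P M.+1 x x''.

(** Each copy of [a] removes at least [a / 2] until the residue is at most [a]. *)
Lemma chain_copies (P : R -> Prop) M x x' a K : chain P M x x' -> P a -> 0 <= a ->
  x' <= (K%:R / 2) * a -> (0 < K)%N -> chain P (M + K) x a.
Proof.
move=> ch Pa a0 hK K0.
have H k : (0 < k)%N -> chain P (M + k) x (Num.max a (x' - k%:R * (a / 2))).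
  elim: k => // -[|k] IH _.
    rewrite addn1; apply: (chainS ch Pa); first by rewrite le_max lexx.
    by rewrite mul1r le_max lexx orbT.
  rewrite addnS; apply: (chainS (IH isT) Pa); first by rewrite le_max lexx.
  have e : k.+2%:R = k.+1%:R + 1 :> R by rewrite natr1.
  have [u|u] := leP a (x' - k.+1%:R * (a / 2)).
    by rewrite le_max e mulrDl; apply/orP; right; lra.
  by rewrite le_max; apply/orP; left; lra.
have := H K K0; rewrite (max_idPl _)//.
have -> : x' - K%:R * (a / 2) = x' - K%:R / 2 * a by ring.
by lra.
Qed.

Lemma chain_seq (P : R -> Prop) M x x' : chain P M x x' ->
  exists (a D : nat -> R), [/\ D 0%N = x, D M = x',
    forall i, (i < M)%N -> P (a i) &
    forall i, (i < M)%N -> a i <= D i.+1 /\ D i - a i / 2 <= D i.+1].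
Proof.
elim=> [y|{}M {}x {}x' x'' b _ [a [D [D0 DM Pa h]]] Pb b1 b2].
  by exists (fun=> 0), (fun=> y).
exists (fun i => if i == M then b else a i), (fun i => if i == M.+1 then x'' else D i).
split=> //=; first by rewrite eqxx.
  by move=> i; rewrite ltnS leq_eqVlt; case: eqP => //= _; apply: Pa.
move=> i; rewrite ltnS leq_eqVlt; case: eqVneq => [->|iM] /= iM'.
  by rewrite eqxx ltn_eqF// DM.
by rewrite eqSS (negbTE iM) ltn_eqF ?(leqW iM')//; apply: h.
Qed.

End Greedy.

(** * Small signed sums from a chain of amplitudes *)

Section SmallSums.
Set Implicit Arguments.
Unset Strict Implicit.
Variable R : realType.

(** The phase shift is at most half the span of the samples; this will confine the phase to an arc
    where the sine is at least [1 / 2]. *)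
Definition realizable (y : R) (m : nat) (A : R) : Prop :=
  0 <= A /\ exists P th, [/\ comb y m P A th, 0 <= th & th <= ((2 ^ m)%:R - 1) * y].

Lemma realizable_one y : realizable y 0 1.
Proof.
split=> //; exists (fun=> Some false), 0; split=> //; first exact: comb_one.
by rewrite expn0 subrr mul0r.
Qed.

Lemma realizable_pad y j m A : 0 <= y -> (j <= m)%N ->
  realizable y j A -> realizable y m A.
Proof.
move=> y0 jm [A0 [P [th [hP th0 thj]]]]; split=> //.
exists (fun l => if (l < 2 ^ j)%N then P l else None), th; split=> //.
  exact: comb_pad.
by apply: le_trans thj _; rewrite ler_wpM2r// lerD2r ler_nat leq_exp2l.
Qed.

Lemma realizable_window (s : seq nat) w e y j A :
  all (fun z : int => (z == 0) || (z == 1) || (z == -1)) (prod_coefs s) ->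
  (sumn s < 2 ^ w)%N -> size s = (4 * e)%N -> 0 <= y ->
  0 <= window s ((2 ^ j)%:R * y) ->
  realizable y j A -> realizable y (j + w) (A * window s ((2 ^ j)%:R * y)).
Proof.
move=> hs sw se y0 W0 [A0 [P [th [hP th0 thj]]]]; split; first exact: mulr_ge0.
exists (fun l => sgmul (P (l %% 2 ^ j)%N) (window_coef s (l %/ 2 ^ j)%N)),
  (th + (sumn s)%:R * ((2 ^ j)%:R * y)); split.
- by apply: comb_mul hP _; apply: comb_window hs sw se.
- by rewrite addr_ge0// !mulr_ge0.
have sw' : (sumn s)%:R <= (2 ^ w)%:R - 1 :> R.
  by rewrite lerBrDr natr1 ler_nat.
have jy : 0 <= (2 ^ j)%:R * y by rewrite mulr_ge0.
rewrite expnD natrM; have := ler_wpM2r jy sw'; move: thj; lra.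
Qed.

(** Write [k = i + 2^tau j]. The [i]-th combination, [i < M], uses only indices with low part [i]
    and with [j] in the upper half, so supports are disjoint and phases lie in [[pi / 4, pi / 2]].
    The remaining terms are signed to total at most 1, where the chain starts. *)
Lemma small_signed_sum (tau m M : nat) (h x : R) :
  h = pi / (2 ^ (tau + m + 3))%:R -> (M <= 2 ^ tau)%N ->
  chain (realizable ((2 ^ tau)%:R * h) m) M 1 x ->
  exists b : nat -> bool,
    `|\sum_(0 <= k < 2 ^ (tau + m + 1)) (-1) ^+ b k * sin ((2 * k + 1)%:R * h)| <= x.
Proof.
move=> hE MT /chain_seq[a [D [D0 DM ha hD]]].
set T := (2 ^ tau)%N in MT *; set Q := (2 ^ m)%N.
have T0 : (0 < T)%N by rewrite expn_gt0.
have Q0 : (0 < Q)%N by rewrite expn_gt0.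
have h0 : 0 < h by rewrite hE divr_gt0 ?pi_gt0// ltr0n expn_gt0.
have piE : pi = 8 * T%:R * Q%:R * h.
  rewrite hE mulrC -mulrA !expnD !natrM -/T -/Q.
  have : T%:R != 0 :> R by rewrite pnatr_eq0 -lt0n.
  have : Q%:R != 0 :> R by rewrite pnatr_eq0 -lt0n.
  by move=> *; field; apply/andP.
set y := T%:R * h in ha *.
pose phi i : R := (2 * (i + T * Q) + 1)%:R * h.
pose good i p := if (i < M)%N then exists th,
  [/\ comb y m p (a i) th, 0 <= th & th <= (Q%:R - 1) * y] else p = fun=> None.
have [P hP] : {P : nat -> nat -> option bool & forall i, good i (P i)}.
  apply: boolp.choice => i; rewrite /good.
  have [iM|iM] := boolP (i < M)%N; last by exists (fun=> None).
  by have [_ [P [th H]]] := ha i iM; exists P, th.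
pose v i : R := \sum_(0 <= l < Q) sgval R (P i l) * sin ((2 * (i + T * (Q + l)) + 1)%:R * h).
have vE i : v i = \sum_(0 <= l < Q) sgval R (P i l) * sin (phi i + (2 * l)%:R * y).
  apply: eq_bigr => l _; congr (_ * sin _); rewrite /phi /y.
  by rewrite mulnDr addnA !mulnDr !natrD !natrM; ring.
have v0 i : (M <= i)%N -> v i = 0.
  move=> iM; have := hP i; rewrite /good ltnNge iM /= => e.
  by rewrite /v e big1// => l _; rewrite mul0r.
have vb i : (i < M)%N -> a i / 2 <= `|v i| <= a i.
  move=> iM; have [a0 _] := ha i iM; have := hP i; rewrite /good iM => -[th [hc th0 th1]].
  rewrite vE hc normrM (ger0_norm a0).
  suff sb : 1 / 2 <= `|sin (phi i + th)| <= 1.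
    by case/andP: sb => s1 s2; apply/andP; split; nra.
  rewrite sin_max andbT.
  have iT : i%:R + 1 <= T%:R :> R by rewrite natr1 ler_nat (leq_trans iM).
  have i0 : 0 <= i%:R :> R by [].
  have TQ : T%:R <= T%:R * Q%:R :> R by rewrite ler_peMr// ler1n.
  have phiE : phi i = 2 * (i%:R * h) + 2 * (T%:R * Q%:R * h) + h.
    by rewrite /phi natrD !natrM natrD natrM; ring.
  have ph : pi / 4 <= phi i + th <= pi / 2.
    have ihT : i%:R * h + h <= T%:R * h.
      by rewrite -[X in _ + X]mul1r -mulrDl ler_wpM2r// ltW.
    have i0h : 0 <= i%:R * h by rewrite mulr_ge0// ltW.
    have TQh : T%:R * h <= T%:R * Q%:R * h by rewrite ler_wpM2r// ltW.
    have piE' : pi = 8 * (T%:R * Q%:R * h) by rewrite piE; ring.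
    have th1' : th <= T%:R * Q%:R * h - T%:R * h by apply: le_trans th1 _; rewrite /y; lra.
    by rewrite phiE piE'; apply/andP; split; lra.
  have pi0 := @pi_gt0 R; move: ph; move: (phi i + th) => z /andP[z1 z2].
  have s0 : 0 <= sin z by apply: sin_ge0_pi; lra.
  (* From [cos (2z) = 1 - 2 sin^2 z <= 0] follows [sin^2 z >= 1 / 2]. *)
  have c2 : cos (z *+ 2) <= 0.
    rewrite -oppr_ge0 -cosDpi.
    have -> : z *+ 2 + pi = z *+ 2 - pi + pi *+ 2 by rewrite !mulr2n; ring.
    by rewrite cosD2pi; apply: cos_ge0_pihalf; rewrite [z *+ 2]mulr2n; lra.
  by rewrite ger0_norm//; move: c2; rewrite cos_mulr2n cos2sin2; nra.
pose C k := if (k %/ T < Q)%N then None else P (k %% T)%N (k %/ T - Q)%N.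
pose f k : R := sin ((2 * k + 1)%:R * h).
have [u hu] : exists u : nat -> bool, `|\sum_(0 <= k < 2 ^ (tau + m + 1))
    (-1) ^+ u k * (if C k is None then f k else 0)| <= 1.
  by apply: greedy_unit => k; case: (C k); rewrite ?normr0// sin_max.
set r0 := \sum_(_ <= _ < _) _ in hu.
have [g hg] : exists g : nat -> bool, `|r0 + \sum_(0 <= i < M) (-1) ^+ g i * v i| <= D M.
  apply: greedy; first by rewrite D0.
  move=> i iM; have [d1 d2] := hD i iM; have /andP[v1 v2] := vb i iM.
  by split; lra.
exists (fun k => if C k is Some c then g (k %% T)%N (+) c else u k).
rewrite -DM; move: hg; congr (`|_| <= _).
(* A term used by a combination takes the common sign [g] of that combination; grouping by low part
   recovers the [v i]. *)
transitivity (r0 + \sum_(0 <= k < 2 ^ (tau + m + 1)) (-1) ^+ g (k %% T)%N * (sgval R (C k) * f k)).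
  congr (_ + _).
  have -> : (2 ^ (tau + m + 1) = T * (Q + Q))%N by rewrite !expnD -/T -/Q expn1; lia.
  rewrite sum_blocks exchange_big_nat/=.
  rewrite [RHS](eq_big_nat _ _ (F2 := fun i => (-1) ^+ g i * v i)).
    rewrite [RHS](@big_cat_nat _ _ _ M 0%N T)//= [X in _ = _ + X]big1_seq ?addr0//.
    by move=> i; rewrite mem_index_iota /= => /andP[/v0 -> _]; rewrite mulr0.
  move=> i /andP[_ iT]; rewrite (@big_cat_nat _ _ _ Q 0%N (Q + Q)%N) ?leq_addr//=.
  have modE j : ((i + T * j) %% T = i)%N by rewrite addnC mulnC modnMDl modn_small.
  have divE j : ((i + T * j) %/ T = j)%N.
    by rewrite addnC mulnC divnMDl// divn_small// addn0.
  rewrite big1_seq ?add0r; last first.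
    by move=> j; rewrite mem_index_iota /= => jQ; rewrite /C divE jQ /= mul0r mulr0.
  rewrite -{1}[Q]add0n big_addn addnK /v mulr_sumr; apply: eq_bigr => l _.
  by rewrite /C divE modE ltnNge leq_addl /= addnK [(l + Q)%N]addnC.
rewrite /r0 -big_split/=; apply: eq_bigr => k _.
by case: (C k) => [c|]; rewrite /= ?mulr0 ?add0r ?mul0r ?mulr0 ?addr0// signr_addb mulrA.
Qed.

End SmallSums.

(** * The ladder of amplitudes *)

Section Ladder.
Set Implicit Arguments.
Unset Strict Implicit.

(* Found by computer search.  What matters is that the product of the
   polynomials 1 - X^a has coefficients in {-1, 0, 1}, that its degree 395 is
   below 2^9, and that the number 20 of factors exceeds 2 * 9. *)
Definition template : seq nat :=
  [:: 2; 4; 5; 6; 9; 11; 13; 14; 15; 17; 19; 21; 23; 25; 27; 29; 31; 35; 40; 49]%N.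

Lemma template_height :
  all (fun z : int => (z == 0) || (z == 1) || (z == -1)) (prod_coefs template).
Proof. by vm_compute. Qed.

Lemma template_range : all (fun a => 0 < a < 2 ^ 9)%N template.
Proof. by []. Qed.

Lemma template_sum : (sumn template < 2 ^ 9)%N.
Proof. by []. Qed.

Variable R : realType.
Variables (y : R) (m : nat).
Hypothesis y0 : 0 < y.
Hypothesis ym : (2 ^ m)%:R * y = pi / 8.

Let W j : R := window template ((2 ^ j)%:R * y).

Let jy j : (j + 9 <= m)%N -> (2 ^ 9)%:R * ((2 ^ j)%:R * y) <= pi / 8.
Proof.
move=> jm; rewrite mulrA -natrM -expnD addnC -ym ler_pM2r//.
by rewrite ler_nat leq_exp2l.
Qed.

Let jy0 j : 0 < (2 ^ j)%:R * y.
Proof. by rewrite mulr_gt0// ltr0n expn_gt0. Qed.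

Let W0 j : (j + 9 <= m)%N -> 0 < W j.
Proof.
move=> jm; apply: (window_gt0 template_range (jy0 j)).
by apply: le_trans (jy jm) _; have := @pi_gt0 R; lra.
Qed.

(** The amplitude of [r] dilates of [template] acting on adjacent windows of 9 bits. *)
Definition amp r : R := \prod_(0 <= t < r) W (9 * t).

Lemma amp_gt0 r : (9 * r <= m)%N -> 0 < amp r.
Proof.
move=> rm; rewrite /amp big_seq; apply: prodr_gt0 => t.
by rewrite mem_index_iota => /andP[_ tr]; apply: W0; lia.
Qed.

(** As [2^(m+1) y <= 1], the factor of index [t] is at most the 20th power of [2^(-9 (r - t - 1))],
    and the exponents [180 (r - t - 1)] add up to [90 r (r - 1)]. *)
Lemma amp_le r : (9 * r <= m)%N ->
  amp r <= (2 ^ (90 * (r * r.-1)))%:R^-1.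
Proof.
move=> rm.
have y1 : (2 ^ m)%:R * y <= 1 / 2.
  by rewrite ym; have := @pihalf_lt2 R; lra.
have Wle t : (t < r)%N -> W (9 * t) <= (2 ^ (180 * (r - t.+1)))%:R^-1.
  move=> tr; apply: le_trans (window_le template_range (jy0 _) _) _.
    by apply: le_trans (jy _) _; [lia|have := @pi_gt0 R; lra].
  have -> : size template = 20%N by [].
  have -> : (180 * (r - t.+1) = 9 * (r - t.+1) * 20)%N by lia.
  have -> B : (2 ^ (B * 20))%:R^-1 = (2 ^ B)%:R^-1 ^+ 20 :> R.
    by rewrite expnM natrX exprVn.
  rewrite lerXn2r ?nnegrE ?invr_ge0//.
    by rewrite mulr_ge0// ltW.
  rewrite -[leRHS]mul1r ler_pdivlMr ?ltr0n ?expn_gt0//.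
  rewrite mulrC mulrA -natrM mulrA -natrM -!expnD.
  have : (2 ^ (9 * (r - t.+1) + (10 + 9 * t)))%:R * y <= (2 ^ m.+1)%:R * y.
    by rewrite ler_pM2r// ler_nat leq_exp2l//; lia.
  by rewrite [(2 ^ m.+1)%N]expnS natrM; lra.
have -> : (90 * (r * r.-1) = \sum_(0 <= t < r) 180 * (r - t.+1))%N.
  rewrite -big_distrr/= big_nat_rev/= (eq_big_nat _ _ (F2 := fun t => t)).
    by rewrite bin2_sum; have := mul_bin_diag r 1; rewrite bin1; lia.
  by move=> t; lia.
suff H q : (q <= r)%N ->
    amp q <= (2 ^ (\sum_(0 <= t < q) 180 * (r - t.+1)))%:R^-1 by exact: H.
rewrite /amp; elim: q => [|q IH] qr.
  by rewrite !big_nil expn0 invr1.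
rewrite !big_nat_recr//= expnD natrM invfM.
apply: ler_pM; [| |exact/IH/ltnW|exact: Wle].
  by apply/ltW/amp_gt0; lia.
by apply/ltW/W0; lia.
Qed.

Lemma realizable_amp r : (9 * r <= m)%N -> realizable y (9 * r) (amp r).
Proof.
elim: r => [|r IH] rm; first by rewrite /amp big_nil muln0; exact: realizable_one.
rewrite /amp big_nat_recr//= mulnS addnC.
apply: (realizable_window template_height template_sum (e := 5)) => //.
- exact: ltW.
- by apply/ltW/W0; lia.
by apply: IH; lia.
Qed.

(** One more window at any free position [j] supplies the rungs between [amp r] and [amp r.+1]. *)
Lemma realizable_item r j : (9 * r <= j)%N -> (j + 9 <= m)%N ->
  realizable y m (amp r * W j).
Proof.
move=> rj jm; apply: (realizable_pad (ltW y0) jm).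
apply: (realizable_window template_height template_sum (e := 5)) => //.
- exact: ltW.
- exact/ltW/W0.
by apply: (realizable_pad (ltW y0) rj); apply: realizable_amp; lia.
Qed.

(** The number of copies of each rung: [K1] covers the ratio [2^20] when a window slides by one bit,
    [K2] the drop when a new window enters at the top. *)
Variable K : nat.
Hypothesis K0 : (0 < K)%N.
Hypothesis K1 : 2 ^+ 20 <= K%:R / 2 :> R.
Hypothesis K2 : 1 <= K%:R / 2 * window template (pi / 8 / (2 ^ 9)%:R) :> R.

Let P := realizable y m.

(** The new window enters at position [m - 9], where its amplitude is a constant, and slides down
    bit by bit, losing at most a factor [2^20] each time. *)
Lemma ladder_item r d M x : (9 * r + d + 9 <= m)%N -> chain P M x (amp r) ->
  chain P (M + K * d.+1) x (amp r * W (m - 9 - d)).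
Proof.
move=> + ch; elim: d => [|d IH] dm.
  have a0 : 0 < amp r by apply: amp_gt0; lia.
  have w0 : 0 < W (m - 9 - 0) by apply: W0; lia.
  rewrite muln1; apply: (chain_copies ch) => //.
  - by apply: realizable_item; lia.
  - by rewrite ltW// mulr_gt0.
  rewrite mulrCA ler_peMr//; first exact: ltW.
  have -> : W (m - 9 - 0) = window template (pi / 8 / (2 ^ 9)%:R).
    congr (window _ _); rewrite -ym subn0.
    have {2}-> : m = ((m - 9) + 9)%N by lia.
    by rewrite expnD natrM [X in X / _]mulrAC mulfK// pnatr_eq0 expn_eq0.
  exact: K2.
have a0 : 0 < amp r by apply: amp_gt0; lia.
have w0 : 0 < W (m - 9 - d.+1) by apply: W0; lia.
rewrite mulnS [(K + _)%N]addnC addnA; apply: (chain_copies (IH _)) => //.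
- by lia.
- by apply: realizable_item; lia.
- by rewrite ltW// mulr_gt0.
rewrite mulrCA ler_pM2l//.
have jE : (m - 9 - d = (m - 9 - d.+1).+1)%N by lia.
rewrite {1}/W jE expnS natrM -mulrA.
apply: le_trans (window_double template_range (jy0 _) _) _.
  have := @jy (m - 9 - d.+1) ltac:(lia); have := @pi_gt0 R; lra.
by rewrite ler_pM2r.
Qed.

(** Once it reaches position [9 * r], the sliding window is the next factor of [amp]. *)
Lemma ladder r : (9 * r <= m)%N -> exists2 M, (M <= K * m.+1 * r)%N & chain P M 1 (amp r).
Proof.
elim: r => [|r IH] rm.
  by exists 0%N => //; rewrite /amp big_nil; exact: chain0.
have [|M hM ch] := IH; first by lia.
exists (M + K * (m - 9 - 9 * r).+1)%N.
  by rewrite [X in (_ <= X)%N]mulnS addnC leq_add// leq_mul//; lia.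
have := @ladder_item r (m - 9 - 9 * r) M 1 ltac:(lia) ch.
have -> : (m - 9 - (m - 9 - 9 * r) = 9 * r)%N by lia.
by rewrite /amp big_nat_recr.
Qed.

End Ladder.

(** * Choice of parameters *)

Section Asymptotics.
Set Implicit Arguments.
Unset Strict Implicit.
Variable R : realType.

Lemma expn4_le t : (16 <= t)%N -> (t ^ 4 <= 2 ^ t)%N.
Proof.
elim: t => // t IH; rewrite leq_eqVlt => /predU1P[<-//|]; rewrite ltnS => t16.
apply: (@leq_trans (2 * t ^ 4)%N); last by rewrite [X in (_ <= X)%N]expnS leq_mul// IH.
have t2 : (16 * t <= t * t)%N by rewrite leq_mul.
have t3 : (16 * (t * t) <= t * (t * t))%N by rewrite leq_mul.
have t4 : (16 * (t * (t * t)) <= t * (t * (t * t)))%N by rewrite leq_mul.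
by rewrite !expnS !expn0 !muln1; lia.
Qed.

Lemma small_signed_sines : exists s0 : nat, forall s, (s0 <= s)%N ->
  exists b : nat -> bool,
    `|\sum_(0 <= k < 2 ^ (s - 2)) (-1) ^+ b k * sin ((2 * k + 1)%:R * (pi / (2 ^ s)%:R)) : R|
      <= (2 ^ (s * (s + 7)))%:R^-1.
Proof.
have pi0 := @pi_gt0 R.
set kappa := window template (pi / 8 / (2 ^ 9)%:R) : R.
have k0 : 0 < kappa.
  apply: (window_gt0 template_range); first by rewrite !divr_gt0// ltr0n.
  by rewrite mulrC divfK ?pnatr_eq0//; lra.
pose x : R := 2 * (2 ^+ 20 + kappa^-1).
have x0 : 0 <= x by rewrite mulr_ge0// addr_ge0 ?exprn_ge0// invr_ge0 ltW.
pose K := (Num.bound x).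
have Kx : x < K%:R by have := archi_boundP x0.
have K1 : 2 ^+ 20 <= K%:R / 2 :> R.
  have : 0 < kappa^-1 by rewrite invr_gt0.
  by move: Kx; rewrite /x; move: (2 ^+ 20) => z; lra.
have K2 : 1 <= K%:R / 2 * kappa.
  rewrite -ler_pdivrMr// mul1r; have : 0 <= 2 ^+ 20 :> R by rewrite exprn_ge0.
  by move: Kx; rewrite /x; move: (2 ^+ 20) => z; lra.
have K0 : (0 < K)%N by rewrite -(ltr0n R); apply: le_lt_trans Kx.
(* As [896 = 128 * 7], the chain length is at most [896 K t^2 <= t^4 <= 2^t]; the 40 absorbs the
   linear terms of the final comparison. *)
exists (64 * (40 + 896 * K))%N => s sK.
set t := (s %/ 64)%N; have sE := divn_eq s 64; rewrite -/t in sE.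
have s64 : (s %% 64 < 64)%N by rewrite ltn_mod.
have tK : (40 + 896 * K <= t)%N by rewrite leq_divRL// mulnC.
(* One bit in 64 separates the combinations; the other [63 t] or so hold [7 t - 1] windows of 9
   bits. The exponent is then about [90 * 49 t^2 = 4410 t^2], against [s^2], about [4096 t^2]. *)
pose m := (s - t - 3)%N; pose r := (7 * t - 1)%N.
set h : R := pi / (2 ^ s)%:R.
have se : (t + m + 3 = s)%N by rewrite /m; lia.
have s2 : (s - 2 = t + m + 1)%N by rewrite /m; lia.
have y0 : 0 < (2 ^ t)%:R * h by rewrite mulr_gt0 ?divr_gt0 ?ltr0n ?expn_gt0.
have ym : (2 ^ m)%:R * ((2 ^ t)%:R * h) = pi / 8.
  have e : (2 ^ s)%:R = (2 ^ (m + t))%:R * 8 :> R.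
    by rewrite -se [(t + m)%N]addnC (expnD 2 (m + t)) natrM.
  rewrite mulrA -natrM -expnD /h e.
  have : (2 ^ (m + t))%:R != 0 :> R by rewrite pnatr_eq0 expn_eq0.
  by move: (2 ^ (m + t))%:R => X X0; field.
have rm : (9 * r <= m)%N by rewrite /r /m; lia.
have [M hM ch] := ladder y0 ym K0 K1 K2 rm.
have Mt : (M <= 2 ^ t)%N.
  apply: leq_trans hM _; apply: leq_trans (expn4_le _); last by lia.
  have m1 : (m.+1 <= 128 * t)%N by rewrite /m; lia.
  have r1 : (r <= 7 * t)%N by rewrite /r; lia.
  apply: (@leq_trans (K * (128 * t) * (7 * t))); first by rewrite !leq_mul.
  have Kt : (896 * K <= t * t)%N by rewrite (leq_trans (_ : _ <= t)%N) ?leq_pmulr//; lia.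
  have := leq_mul Kt (leqnn (t * t)).
  by rewrite !expnS expn0 muln1; lia.
have hE : h = pi / (2 ^ (t + m + 3))%:R by rewrite se.
have [b hb] := small_signed_sum hE Mt ch.
exists b; rewrite s2; apply: le_trans hb _; apply: le_trans (amp_le y0 ym rm) _.
rewrite lef_pV2 ?posrE ?ltr0n ?expn_gt0// ler_nat leq_exp2l//.
have st : (s <= 64 * t + 63)%N by lia.
have t40 : (40 * t <= t * t)%N by rewrite leq_mul//; lia.
apply: (@leq_trans ((64 * t + 63) * (64 * t + 70))); first by rewrite leq_mul//; lia.
have -> : r = (7 * (t - 1) + 6)%N by rewrite /r; lia.
have tE : t = (t - 1).+1 by lia.
rewrite {1 2}tE; rewrite tE in t40; move: (t - 1)%N t40 => q q40; rewrite addnS/=.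
by lia.
Qed.

End Asymptotics.

(** * The optimal signs and their polygon *)

Section Sigma.
Set Implicit Arguments.
Unset Strict Implicit.
Variable R : realType.
Variables (s n : nat).
Hypothesis s4 : (4 <= s)%N.
Hypothesis nE : n = (2 ^ s)%N.

Let h : R := pi / n%:R.

Definition signed_sines (b : nat -> bool) : R :=
  \sum_(0 <= k < 2 ^ (s - 2)) (-1) ^+ b k * sin ((2 * k + 1)%:R * (pi / n%:R)).

Definition cosines : R := \sum_(0 <= k < 2 ^ (s - 2)) cos ((2 * k + 1)%:R * (pi / n%:R)).

Lemma n_quarter : n = (4 * 2 ^ (s - 2))%N.
Proof. by rewrite nE -{1}(subnK (_ : 2 <= s)%N) ?expnD 1?mulnC//; lia. Qed.

Lemma n_div4 : (n %/ 4 = 2 ^ (s - 2))%N.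
Proof. by rewrite n_quarter mulKn. Qed.

Lemma n_ge16 : (16 <= n)%N.
Proof. by rewrite nE; apply: (@leq_trans (2 ^ 4)); rewrite ?leq_exp2l. Qed.

Lemma step_bounds : [/\ 0 < h, h < pi / 2 & h <= 1].
Proof.
have n16 : 16 <= n%:R :> R by rewrite ler_nat n_ge16.
have pi0 := @pi_gt0 R; have pi4 := @pihalf_lt2 R.
have n0 : 0 < n%:R :> R by lra.
have hn : h * n%:R = pi by rewrite /h divfK// gt_eqF.
have h0 : 0 < h by rewrite divr_gt0.
by split=> //; nra.
Qed.

(** The first term is at least [cos 1] because [h <= 1], and the others are nonnegative. *)
Lemma cosines_ge : cos 1 <= cosines.
Proof.
have [h0 h2 h1] := step_bounds.
have q0 : (0 < 2 ^ (s - 2))%N by rewrite expn_gt0.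
have hpi : (4 * 2 ^ (s - 2))%:R * h = pi.
  by rewrite -n_quarter mulrC divfK// pnatr_eq0 nE expn_eq0.
have pi0 := @pi_gt0 R; have pi4 := @pi_ge2 R.
rewrite /cosines big_ltn// muln0 add0n mul1r -/h -[cos 1]addr0 lerD//.
  by rewrite leNgt ltr_cos -?leNgt// in_itv/=; lra.
rewrite big_seq; apply: sumr_ge0 => k; rewrite mem_index_iota => /andP[_ kq].
have k1 : (2 * k + 1)%:R * h <= (2 * 2 ^ (s - 2))%:R * h.
  by rewrite ler_pM2r// ler_nat; lia.
have k2 : (4 * 2 ^ (s - 2))%:R * h = 2 * ((2 * 2 ^ (s - 2))%:R * h).
  by rewrite !natrM; ring.
have k3 : 0 <= (2 * k + 1)%:R * h by rewrite mulr_ge0// ltW.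
by apply: cos_ge0_pihalf; lra.
Qed.

Lemma cosines_gt0 : 0 < cosines.
Proof. exact: lt_le_trans (cos1_gt0 R) cosines_ge. Qed.

Lemma sigma_ratioE (b : nat -> bool) :
  @sigma_ratio R n [ffun k : 'I_(n %/ 4) => b k] = `|signed_sines b| / cosines.
Proof.
rewrite /sigma_ratio /signed_sines /cosines -n_div4 !big_mkord; congr (`|_| / _).
by apply: eq_bigr => k _; rewrite ffunE.
Qed.

Lemma ffun_of_nat (c : {ffun 'I_(n %/ 4) -> bool}) :
  exists b : nat -> bool, c = [ffun k : 'I_(n %/ 4) => b k].
Proof.
exists (fun k => oapp c false (insub k)).
by apply/ffunP => k; rewrite ffunE valK.
Qed.

Lemma sigma_le b : sigma R n <= `|signed_sines b| / cosines.
Proof. by rewrite -sigma_ratioE; apply: bigmin_le. Qed.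

Lemma sigma_attained : exists b, sigma R n = `|signed_sines b| / cosines.
Proof.
have [c ->] : exists c, sigma R n = @sigma_ratio R n c.
  rewrite /sigma; elim/big_ind: _ => [|x y [c ->] [d ->]|c _].
  - by exists [ffun=> false].
  - by rewrite minEle; case: ifP => _; [exists c|exists d].
  - by exists c.
by have [b ->] := ffun_of_nat c; exists b; rewrite sigma_ratioE.
Qed.

Lemma sigma_gt0 : 0 < sigma R n.
Proof.
have [b ->] := sigma_attained; rewrite divr_gt0 ?cosines_gt0// normr_gt0.
by rewrite /signed_sines nE; apply: signed_sines_neq0; lia.
Qed.

Lemma delta_solution_delta : delta_solution n (delta R n).
Proof.
have [h0 h2 h1] := step_bounds; split.
  exact: (tilt_gap_bounds sigma_gt0 h0 h2).
exact: (tilt_gapE sigma_gt0 h0 h2).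
Qed.

Lemma delta_solution_unique x : delta_solution n x -> x = delta R n.
Proof.
have [h0 h2 h1] := step_bounds => -[xb].
exact: (tilt_gap_unique sigma_gt0 h0 h2).
Qed.

Lemma delta_le : delta R n <= sigma R n / cos 1.
Proof.
have [h0 h2 h1] := step_bounds.
exact: (tilt_gap_le sigma_gt0 h0 h2).
Qed.

Lemma optimal_polygon : exists P : polygon R n,
  [/\ convex_polygon P, small P,
      perimeter P = 2 * n%:R * sin (pi / (2 * n%:R)) * cos (delta R n / 2)
    & width P = cos (pi / (2 * n%:R) + delta R n / 2)].
Proof.
have [/andP[d0 dh] dE] := delta_solution_delta; have [b bE] := sigma_attained.
apply: (@polygon_of_signs R (2 ^ (s - 2)) b (delta R n) _ n (pi / n%:R) n_quarter
  (erefl _) d0 dh (signed_sines b) cosines (erefl _) (erefl _)).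
  by rewrite expn_gt0.
(* Multiplied by [cosines], the equation of delta is the closing condition. *)
rewrite -dE bE [RHS]mulrC mulrA; congr (_ * _).
by rewrite mulrC divfK// gt_eqF// cosines_gt0.
Qed.

End Sigma.

(** * Convergence rates *)

Section Rates.
Set Implicit Arguments.
Unset Strict Implicit.
Variable R : realType.

(** The finitely many early ratios are added to the constant. *)
Lemma eventual_bound (f g : nat -> R) s0 C0 : (forall s, 0 < g s) ->
  (forall s, (s0 <= s)%N -> f s <= C0 * g s) ->
  exists2 C, 0 <= C & forall s, f s <= C * g s.
Proof.
move=> g0 hf; exists (`|C0| + \sum_(0 <= i < s0) `|f i| / g i).
  by apply: addr_ge0 => //; apply: sumr_ge0 => i _; rewrite divr_ge0// ltW.
move=> s; rewrite mulrDl; have [ss|ss] := leqP s0 s.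
  apply: le_trans (hf s ss) _; rewrite -[leLHS]addr0 lerD//.
    by rewrite ler_pM2r// ler_norm.
  apply: mulr_ge0; last exact: ltW.
  by apply: sumr_ge0 => i _; rewrite divr_ge0// ltW.
rewrite -[leLHS]add0r lerD//; first by rewrite mulr_ge0// ltW.
apply: le_trans (ler_norm _) _; rewrite -ler_pdivrMr//.
rewrite (bigD1_seq s)/= ?iota_uniq ?mem_index_iota// lerDl.
by apply: sumr_ge0 => i _; rewrite divr_ge0// ltW.
Qed.

Lemma cos_diff_le (a x : R) : 0 <= x <= pi -> cos a - cos (a + x) <= x.
Proof.
move=> xb; set c := a + x / 2.
have -> : cos a = cos (c - x / 2) by congr cos; rewrite /c; ring.
have -> : cos (a + x) = cos (c + x / 2) by congr cos; rewrite /c; lra.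
have -> : cos (c - x / 2) - cos (c + x / 2) = 2 * (sin c * sin (x / 2)).
  by rewrite cosB cosD; ring.
have s0 : 0 <= sin (x / 2) by apply: sin_ge0_pi; lra.
have s1 : sin (x / 2) <= x / 2 by apply: sin_le_id; lra.
have := sin_le1 c; nra.
Qed.

Lemma log2X k : log2 ((2 ^ k)%:R : R) = k%:R.
Proof.
rewrite /log2 natrX lnXn ?ltr0n// -[ln _ *+ _]mulr_natl mulfK//.
by rewrite gt_eqF// ln_gt0// ltr1n.
Qed.

(** For [n = 2^s] the denominator is [2^(s (s + c))] and the numerator, a power of pi, is at least
    1; [c <= 7] covers both rates. *)
Lemma rate_ge (s c : nat) : (c <= 7)%N ->
  (2 ^ (s * (s + 7)))%:R^-1 <=
  pi `^ (log2 ((2 ^ s)%:R ^+ 2)) / (2 ^ s)%:R `^ (log2 (2 ^ s)%:R + c%:R) :> R.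
Proof.
move=> c7; rewrite -natrX -expnM !log2X -natrD powR_mulrn// ?pi_ge0//.
rewrite powR_mulrn// -natrX -expnM -[leLHS]mul1r ler_pM ?invr_ge0//.
  by rewrite exprn_ege1// (le_trans _ (@pi_ge2 R))// ler1n.
rewrite lef_pV2 ?posrE ?ltr0n ?expn_gt0// ler_nat leq_exp2l// leq_mul2l leq_add2l.
by rewrite c7 orbT.
Qed.

(** Delta is at most [sigma / cos 1], and dividing by [cosines >= cos 1] costs a second factor. *)
Lemma delta_rate : exists2 C : R, 0 <= C & forall s, (4 <= s)%N ->
  delta R (2 ^ s) <= C * (2 ^ (s * (s + 7)))%:R^-1.
Proof.
have c1 := cos1_gt0 R; have [s0 hs] := small_signed_sines R.
have [|s|C C0 hC] := @eventual_bound (fun s => delta R (2 ^ s))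
    (fun s => (2 ^ (s * (s + 7)))%:R^-1) (maxn 4 s0) (cos 1 ^- 2).
- by move=> s; rewrite invr_gt0 ltr0n expn_gt0.
- rewrite geq_max => /andP[s4 ss]; have [b hb] := hs s ss.
  apply: le_trans (delta_le R s4 erefl) _.
  rewrite expr2 invfM -mulrA mulrC ler_pM2l ?invr_gt0//.
  apply: le_trans (sigma_le R s4 erefl b) _; rewrite mulrC.
  apply: ler_pM => //; first by rewrite invr_ge0 ltW// (cosines_gt0 R s4 erefl).
  by rewrite lef_pV2 ?posrE ?(cosines_gt0 R s4 erefl)// (cosines_ge R s4 erefl).
by exists C.
Qed.

End Rates.

Theorem theorem1p1 (R : realType) :
  (forall s n : nat, (4 <= s)%N -> n = (2 ^ s)%N ->
     delta_solution n (delta R n) /\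
     (forall x : R, delta_solution n x -> x = delta R n)) /\
  (exists D : forall n : nat, polygon R n,
     [/\ forall s n : nat, (4 <= s)%N -> n = (2 ^ s)%N ->
           [/\ convex_polygon (D n),
               small (D n),
               perimeter (D n) =
                 2 * n%:R * sin (pi / (2 * n%:R)) * cos (delta R n / 2)
             & width (D n) = cos (pi / (2 * n%:R) + delta R n / 2)],
         exists C : R, forall s n : nat, (4 <= s)%N -> n = (2 ^ s)%N ->
           Lbar R n - perimeter (D n)
             <= C * (pi `^ (log2 (n%:R ^+ 2)) / n%:R `^ (log2 n%:R + 5))
       & exists C : R, forall s n : nat, (4 <= s)%N -> n = (2 ^ s)%N ->
           Wbar R n - width (D n)
             <= C * (pi `^ (log2 (n%:R ^+ 2)) / n%:R `^ (log2 n%:R + 7))]).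
Proof.
split.
  move=> s n s4 nE; split; first exact: delta_solution_delta s4 nE.
  by move=> x; apply: delta_solution_unique s4 nE _.
pose good n (P : polygon R n) := [/\ convex_polygon P, small P,
  perimeter P = 2 * n%:R * sin (pi / (2 * n%:R)) * cos (delta R n / 2)
  & width P = cos (pi / (2 * n%:R) + delta R n / 2)].
have [D hD] : exists D : forall n, polygon R n,
    forall n, (exists2 s, (4 <= s)%N & n = (2 ^ s)%N) -> good n (D n).
  have H n : exists P : polygon R n, (exists2 s, (4 <= s)%N & n = (2 ^ s)%N) -> good n P.
    have [[s s4 nE]|no] := pselect (exists2 s, (4 <= s)%N & n = (2 ^ s)%N).
      by have [P hP] := optimal_polygon R s4 nE; exists P.
    (* A default value for the remaining [n]. *)
    by exists (fun=> 0).
  by exists (fun n => projT1 (cid (H n))) => n; exact: (projT2 (cid (H n))).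
have hDs s n : (4 <= s)%N -> n = (2 ^ s)%N -> good n (D n).
  by move=> s4 nE; apply: hD; exists s.
(* Both gaps are at most a constant times delta, which is already of the order of the sharper
   rate. *)
have [C C0 hC] := delta_rate R.
have d0 s : (4 <= s)%N -> 0 <= delta R (2 ^ s) <= 1.
  move=> s4; have [_ _ h1] := step_bounds R s4 erefl.
  by have [/andP[? ?] _] := delta_solution_delta R s4 erefl; lra.
have pi0 := pi_gt0 R; have pi2 := @pi_ge2 R.
exists D; split; first exact: hDs.
  exists (pi * C) => s n s4 nE; have [_ _ -> _] := hDs s n s4 nE.
  rewrite nE /Lbar; have db := d0 s s4.
  set x := 2 * _ * _.
  have -> : x - x * cos (delta R (2 ^ s) / 2) =
    x * (cos 0 - cos (0 + delta R (2 ^ s) / 2)) by rewrite cos0 add0r; ring.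
  have n0 : 0 < (2 ^ s)%:R :> R by rewrite ltr0n expn_gt0.
  have xpi : 0 <= x <= pi.
    have zE : 2 * (2 ^ s)%:R * (pi / (2 * (2 ^ s)%:R)) = pi :> R.
      by rewrite mulrC divfK// mulf_neq0 ?pnatr_eq0 ?expn_eq0.
    have z0 : 0 < pi / (2 * (2 ^ s)%:R) :> R by rewrite divr_gt0// mulr_gt0.
    have n1 : 1 <= (2 ^ s)%:R :> R by rewrite ler1n expn_gt0.
    have s0 : 0 <= sin (pi / (2 * (2 ^ s)%:R)) :> R by apply: sin_ge0_pi; nra.
    apply/andP; split; first by rewrite /x !mulr_ge0.
    by rewrite -[leRHS]zE ler_pM2l ?mulr_gt0// sin_le_id// ltW.
  apply: (@le_trans _ _ (pi * delta R (2 ^ s))).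
    have := @cos_diff_le R 0 (delta R (2 ^ s) / 2) ltac:(lra).
    have : 0 <= cos 0 - cos (0 + delta R (2 ^ s) / 2) by rewrite cos0 subr_ge0 cos_le1.
    by move: (cos 0 - _) xpi => u; nra.
  rewrite -mulrA ler_pM2l//; apply: le_trans (hC s s4) _.
  by rewrite ler_wpM2l// rate_ge.
exists C => s n s4 nE; have [_ _ _ ->] := hDs s n s4 nE.
rewrite nE /Wbar; have db := d0 s s4.
apply: (@le_trans _ _ (delta R (2 ^ s))).
  have := @cos_diff_le R (pi / (2 * (2 ^ s)%:R)) (delta R (2 ^ s) / 2) ltac:(lra).
  by lra.
apply: le_trans (hC s s4) _.
by rewrite ler_wpM2l// rate_ge.
Qed.
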